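(* Let $(X,\Sigma,\mu)$ be a complete $\sigma$-finite measure space, $\mathcal{A}\subseteq\Sigma$ a sub-$\sigma$-finite algebra, $E=E^{\mathcal{A}}$ the associated conditional expectation, and $u,w\in\mathcal{D}(E)$ such that $T=M_wEM_u$ is a bounded operator on $L^2(\Sigma)$. Let $S=S(E(|u|^2))$ and $S'=S(E(u))$. Then: (a) If $|E(uw)|^2\geq E(|u|^2)E(|w|^2)$ on $S$, then $T$ belongs to the $A$-class. (b) If $T$ belongs to the $A$-class, then $|E(uw)|^2\geq E(|u|^2)E(|w|^2)$ on $S'$. (c) If $S=S'$, then $T$ belongs to the $A$-class if and only if $|E(uw)|^2\geq E(|u|^2)E(|w|^2)$ on $S$.
   Context: For a sub-$\sigma$-finite algebra $\mathcal{A}\subseteq\Sigma$, $E=E^{\mathcal{A}}$ denotes the conditional expectation: for $f\geq 0$ measurable or $f\in L^2(\Sigma)$, $Ef$ is the unique $\mathcal{A}$-measurable function with $\int_A f\,d\mu=\int_A Ef\,d\mu$ for all $A\in\mathcal{A}$. $\mathcal{D}(E)=\{g\in L^0(\Sigma): E(|g|)\in L^0(\mathcal{A})\}$, where $L^0$ denotes a.e. finite measurable functions. $M_w$ is multiplication by $w$, so $M_wEM_u f=wE(uf)$. The support of $f$ is $S(f)=\{x: f(x)\neq 0\}$. All comparisons between functions or sets hold up to $\mu$-null sets. For a bounded operator $T$ on a Hilbert space, $|T|=(T^*T)^{1/2}$; $T$ belongs to the $A$-class if $|T|^2\leq |T^2|$ (as positive operators). *)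

(* Defs.v *)
From HB Require Import structures.
From mathcomp Require Import all_boot all_order all_algebra.
From mathcomp Require Import all_classical all_reals all_analysis measurable_realfun.
From mathcomp Require Import complex.
Set Implicit Arguments. Unset Strict Implicit. Unset Printing Implicit Defensive.
Import Order.TTheory GRing.Theory Num.Theory.
Local Open Scope classical_set_scope.
Local Open Scope ring_scope.

Section WCE.
Context {R : realType} {d : measure_display} {X : measurableType d}.
Implicit Types (mu : {measure set X -> \bar R}) (A : set (set X)).

Definition cmul (z z' : R[i]) : R[i] :=
  Complex (complex.Re z * complex.Re z' - complex.Im z * complex.Im z') (complex.Re z * complex.Im z' + complex.Im z * complex.Re z').
Definition cadd (z z' : R[i]) : R[i] := Complex (complex.Re z + complex.Re z') (complex.Im z + complex.Im z').
Definition cconj (z : R[i]) : R[i] := Complex (complex.Re z) (- complex.Im z).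
Definition cnormsq (z : R[i]) : R := complex.Re z ^+ 2 + complex.Im z ^+ 2.
Definition cabs (z : R[i]) : R := Num.sqrt (cnormsq z).

Definition posp (r : R) : R := Num.max r 0.
Definition negp (r : R) : R := Num.max (- r) 0.

Definition sub_sigma_finite mu A : Prop :=
  [/\ sigma_algebra setT A, A `<=` measurable &
      exists2 F : (set X)^nat, setT = \bigcup_i F i &
        forall i, A (F i) /\ (mu (F i) < +oo)%E].

Definition A_measurable A (g : X -> \bar R) : Prop :=
  forall Y : set (\bar R), measurable Y -> A (g @^-1` Y).

Definition cmeasurable (f : X -> R[i]) : Prop :=
  measurable_fun setT (fun x => complex.Re (f x)) /\ measurable_fun setT (fun x => complex.Im (f x)).

Definition condexp_nonneg mu A (f g : X -> \bar R) : Prop :=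
  [/\ A_measurable A g, (forall x, (0 <= g x)%E) &
      forall B, A B -> (\int[mu]_(x in B) f x = \int[mu]_(x in B) g x)%E].

Definition inDE mu A (u : X -> R[i]) : Prop :=
  cmeasurable u /\
  exists h, condexp_nonneg mu A (fun x => (cabs (u x))%:E) h /\
            {ae mu, forall x, (h x < +oo)%E}.

Definition condexp mu A (f g : X -> R[i]) : Prop :=
  exists a b c e : X -> \bar R,
    [/\ condexp_nonneg mu A (fun x => (posp (complex.Re (f x)))%:E) a,
        condexp_nonneg mu A (fun x => (negp (complex.Re (f x)))%:E) b,
        condexp_nonneg mu A (fun x => (posp (complex.Im (f x)))%:E) c,
        condexp_nonneg mu A (fun x => (negp (complex.Im (f x)))%:E) e &
        g = fun x => Complex (fine (a x) - fine (b x)) (fine (c x) - fine (e x))].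

Definition norm2sq mu (f : X -> R[i]) : \bar R :=
  (\int[mu]_x (cnormsq (f x))%:E)%E.

Definition L2 mu (f : X -> R[i]) : Prop :=
  cmeasurable f /\ (norm2sq mu f < +oo)%E.

Definition ip mu (f g : X -> R[i]) : R[i] :=
  Complex (Rintegral mu setT (fun x => complex.Re (cmul (f x) (cconj (g x)))))
          (Rintegral mu setT (fun x => complex.Im (cmul (f x) (cconj (g x))))).

(* Operators on L^2 are represented by maps on representatives. *)
Definition bounded_L2 mu (T : (X -> R[i]) -> (X -> R[i])) : Prop :=
  exists K : R, forall f, L2 mu f ->
    L2 mu (T f) /\ (norm2sq mu (T f) <= K%:E * norm2sq mu f)%E.

Definition is_wce_op mu A (u w : X -> R[i]) (T : (X -> R[i]) -> (X -> R[i])) : Prop :=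
  forall f, L2 mu f -> forall g, condexp mu A (fun x => cmul (u x) (f x)) g ->
    {ae mu, forall x, T f x = cmul (w x) (g x)}.

(* S is (a representative of) |T^2| = ((T^2)^* T^2)^{1/2}: the bounded linear
   positive self-adjoint operator with S^2 = (T^2)^* T^2, i.e.
   <S f, S g> = <T^2 f, T^2 g>. *)
Definition is_abs_T2 mu (T S : (X -> R[i]) -> (X -> R[i])) : Prop :=
  [/\ bounded_L2 mu S,
      (forall f g (a b : R[i]), L2 mu f -> L2 mu g ->
         {ae mu, forall x, S (fun y => cadd (cmul a (f y)) (cmul b (g y))) x
                          = cadd (cmul a (S f x)) (cmul b (S g x))}),
      (forall f g, L2 mu f -> L2 mu g -> ip mu (S f) g = ip mu f (S g)),
      (forall f, L2 mu f -> 0 <= complex.Re (ip mu (S f) f)) &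
      (forall f g, L2 mu f -> L2 mu g ->
         ip mu (S f) (S g) = ip mu (T (T f)) (T (T g)))].

(* A-class: |T|^2 <= |T^2|, i.e. <T^* T f, f> = ||T f||^2 <= <|T^2| f, f> *)
Definition A_class mu (T : (X -> R[i]) -> (X -> R[i])) : Prop :=
  forall S, is_abs_T2 mu T S ->
    forall f, L2 mu f -> fine (norm2sq mu (T f)) <= complex.Re (ip mu (S f) f).

Definition ineq_on mu (P : set X) (euw : X -> R[i]) (eu ew : X -> \bar R) : Prop :=
  {ae mu, forall x, P x -> (eu x * ew x <= (cnormsq (euw x))%:E)%E}.

Definition ae_eqset mu (P Q : set X) : Prop :=
  mu.-negligible ((P `\` Q) `|` (Q `\` P)).

End WCE.

(* Main.v *)
Require Import Defs.
From HB Require Import structures.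
From mathcomp Require Import all_boot all_order all_algebra.
From mathcomp Require Import all_classical all_reals all_analysis measurable_realfun.
From mathcomp Require Import complex.
From mathcomp Require Import ring lra.
Set Implicit Arguments. Unset Strict Implicit. Unset Printing Implicit Defensive.
Import Order.TTheory GRing.Theory Num.Theory.
Import numFieldNormedType.Exports.
Local Open Scope classical_set_scope.
Local Open Scope ring_scope.

(* With E|u|^2 and E|w|^2 finite and positive, replace u by u / sqrt(E|u|^2) and
   w by w sqrt(E|u|^2); off that set T vanishes, because boundedness of T forces
   E|u|^2 E|w|^2 <= K. Then E|u|^2 is an indicator chi, om = E|w|^2 is bounded,
   e_f = E(uf) maps L^2(Sigma) into L^2(A), T f = w e_f and e_(Tf) = q e_f with
   q = E(uw). Hence T^*T f = conj(u) om e_f and |T^2| f = conj(u) a e_f with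
   a = sqrt(om) |q|.
   If om <= |q|^2, then |T^*T f| <= |T^2 f| for all f, and operator monotonicity
   of the square root (proved with approximate eigenvectors, so that no spectral
   theorem is needed) gives the A-class inequality for every operator that
   qualifies as |T^2|. Conversely, testing the A-class inequality for this
   explicit |T^2| on f = conj(u) k with k in L^2(A) gives om <= a, that is
   om <= |q|^2, almost everywhere. *)

(** The A-class is shown equivalent to the inequality almost everywhere on X; where E|u|^2 = 0 its
    left side is 0, so this is the inequality on S, and (b) is a restriction of it. The obstacle is
    that neither E|u|^2 nor E|w|^2 is known to be finite, and that uf need not be integrable for f
    in L^2(Sigma). The bound E|u|^2 E|w|^2 <= K is therefore reached by truncating |u|, and E(uf) is
    handled by duality, tested against an A-measurable k only when k u f is integrable. Rescaling
    does not change T because the two factors multiply to the indicator of the good set, off which w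
    or E(uf) vanishes. Both directions are comparisons of weights for |e_f|^2: the squared norms of
    T^*T f and T^2 f have weights om^2 and om |q|^2, while the quadratic forms of T^*T and of |T^2|
    have weights om and sqrt(om) |q|. *)

(** * Operator monotonicity of the square root for a degenerate form *)

Section LoewnerHeinz.
Context {R : realType} {V : Type}.
Variables (n : V -> V -> R) (comb : V -> R -> V -> V) (P S : V -> V) (K : R).
Hypotheses (n_sym : forall f g, n f g = n g f)
  (n_comb : forall f t g k, n (comb f t g) k = n f k + t * n g k)
  (n_ge0 : forall f, 0 <= n f f) (K0 : 0 <= K).
Hypotheses (P_sym : forall f g, n (P f) g = n f (P g))
  (P_ge0 : forall f, 0 <= n (P f) f)
  (P_bnd : forall f, n (P f) (P f) <= K * n f f).
Hypotheses (S_sym : forall f g, n (S f) g = n f (S g))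
  (S_ge0 : forall f, 0 <= n (S f) f)
  (S_bnd : forall f, n (S f) (S f) <= K * n f f).

Let expand f t g : n (comb f t g) (comb f t g) =
  n f f + 2 * t * n f g + t ^+ 2 * n g g.
Proof. by rewrite n_comb (n_sym f) (n_sym g) !n_comb (n_sym g f); ring. Qed.

Let expand_op (U : V -> V) f t g : (forall f g, n (U f) g = n f (U g)) ->
  n (U (comb f t g)) (comb f t g) =
  n (U f) f + 2 * t * n (U f) g + t ^+ 2 * n (U g) g.
Proof.
move=> sU; have e1 k : n k (U (comb f t g)) = n (U k) f + t * n (U k) g.
  by rewrite -sU n_sym n_comb (n_sym f) (n_sym g).
rewrite n_sym n_comb !e1 (sU g f) (n_sym g (U f)); ring.
Qed.

Let op_le (U : V -> V) f : n (U f) (U f) <= K * n f f ->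
  2 * n (U f) f <= (K + 1) * n f f.
Proof. by move=> bU; have := n_ge0 (comb (U f) (-1) f); rewrite expand; lra. Qed.

(** If l0 > 0 were the supremum of <(P - S) g, g> over unit g, then at a near-maximizer (P - S) g is
    nearly l0 g, so <(P - S) g, (P + S) g> is nearly l0 <g, (P + S) g> and stays positive, whereas
    it equals |P g|^2 - |S g|^2 <= 0. Made quantitative, this yields a smaller bound l1 < l0. The
    form [n] may be degenerate and [comb f t g] stands for f + t g, so that functions need not be
    taken modulo null sets. *)
Lemma loewner_heinz_sqrt (f : V) :
  (forall g, n (P g) (P g) <= n (S g) (S g)) -> n (P f) f <= n (S f) f.
Proof.
move=> PS; pose D g := n (P g) g - n (S g) g.
(* The nonnegative upper bounds of the numerical range of P - S. The infimum l0 is again such a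
   bound, and the aim is l0 = 0. *)
pose L := [set l | 0 <= l /\ forall g, D g <= l * n g g].
have LK : L ((K + 1) / 2).
  split=> [|g]; first by rewrite divr_ge0 // addr_ge0.
  by rewrite /D; have := op_le (P_bnd g); have := S_ge0 g; lra.
have L0 : lbound L 0 by move=> l [].
have hL : has_inf L by split; [exists ((K + 1) / 2)|exists 0].
pose l0 := inf L.
have l00 : 0 <= l0 by apply: lb_le_inf => //; exists ((K + 1) / 2).
have l0min l : L l -> l0 <= l by move=> Ll; apply: ge_inf => //; exists 0.
have Dl0 g : D g <= l0 * n g g.
  have [z|nz] := eqVneq (n g g) 0.
    by have [_ /(_ g)] := LK; rewrite z !mulr0.
  have gp : 0 < n g g by rewrite lt_neqAle eq_sym nz n_ge0.
  rewrite -ler_pdivrMr //; apply: lb_le_inf; first by exists ((K + 1) / 2).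
  by move=> l [_ Dl]; rewrite ler_pdivrMr.
have [l0z|l0nz] := eqVneq l0 0.
  by have := Dl0 f; rewrite l0z mul0r /D subr_le0.
have l0p : 0 < l0 by rewrite lt_neqAle eq_sym l0nz.
exfalso.
(* Bounds the form of l0 - (P - S): P is nonnegative and 2 <S h, h> <= (K + 1) |h|^2. *)
pose C := l0 + (K + 1) / 2.
have Cp : 0 < C by rewrite ltr_wpDr // divr_ge0 // addr_ge0.
have CE : C = l0 + (K + 1) / 2 by [].
clearbody C.
(* The weight for Young's inequality in [hv], large enough that 4 K / r < 2 l0^2, which amounts to
   l1 < l0. *)
pose r := (2 * K + 1) / l0 ^+ 2.
have rp : 0 < r by rewrite divr_gt0 ?exprn_gt0 // ltr_wpDl // mulr_ge0.
have rl : r * l0 ^+ 2 = 2 * K + 1 by rewrite /r divfK // expf_neq0.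
clearbody r.
(* The solution l of 2 l0 l = r C (l0 - l) + 4 K / r, the balance between the lower and upper
   estimates of 2 <h, v> for |g| = 1. *)
pose l1 := (r * C * l0 + 4 * K / r) / (2 * l0 + r * C).
have dp : 0 < 2 * l0 + r * C by rewrite addr_gt0 // mulr_gt0.
have Kr : 4 * K / r < 2 * l0 ^+ 2.
  rewrite ltr_pdivrMr //; lra.
suff : L l1.
  move/l0min; rewrite leNgt => /negP; apply.
  rewrite /l1 ltr_pdivrMr //.
  rewrite mulrDr -subr_gt0; move: Kr; set a := 4 * K / r; move: a => a; nra.
split=> [|g].
  rewrite divr_ge0 ?ltW // ltr_wpDr ?mulr_gt0 //.
  by rewrite divr_ge0 ?mulr_ge0 // ltW.
(* [h] is [(l0 - (P - S)) g]: small when [g] nearly attains the supremum [l0] of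
   the numerical range of [P - S], by positivity of the form of [l0 - (P - S)]. *)
pose h := comb (comb (S g) (-1) (P g)) l0 g.
have nh k : n h k = n (S g) k - n (P g) k + l0 * n g k.
  by rewrite !n_comb; ring.
pose Q := l0 * n g g - D g.
(* Positivity of M = l0 - (P - S) at g - h / C, where h = M g: 0 <= Q - 2 |h|^2 / C + <M h, h> /
   C^2, and <M h, h> <= C |h|^2. *)
have HQ : n h h <= C * Q.
  have := Dl0 (comb g (- C^-1) h).
  rewrite /D (expand_op g _ h P_sym) (expand_op g _ h S_sym) expand.
  have Dh : l0 * n h h - D h <= C * n h h.
    by rewrite /D CE; have := op_le (S_bnd h); have := P_ge0 h; lra.
  have := nh h; set H := n h h in Dh *; rewrite (n_sym g h) => HE Dle.
  have i2 : (C^-1) ^+ 2 * (l0 * H - D h) <= C^-1 * H.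
    have : (C^-1) ^+ 2 * (l0 * H - D h) <= (C^-1) ^+ 2 * (C * H).
      by rewrite ler_wpM2l // sqr_ge0.
    suff -> : (C^-1) ^+ 2 * (C * H) = C^-1 * H by [].
    by field; rewrite gt_eqF.
  have : C^-1 * H <= Q.
    have := congr1 ( *%R C^-1) HE.
    move: i2 Dle; rewrite /Q /D.
    set c := C^-1; move: c => c. lra.
  by rewrite ler_pdivrMl.
pose v := comb (P g) 1 (S g).
have nv k : n k v = n (P g) k + n (S g) k.
  by rewrite n_sym n_comb mul1r.
(* The cross terms of <(P - S) g, (P + S) g> cancel, leaving |P g|^2 - |S g|^2 <= 0; hence <h, v> >=
   l0 <(P + S) g, g> >= l0 D g. *)
have l0x : l0 * D g <= n h v.
  have := PS g; rewrite nh (n_sym _ v) (n_sym _ v) (n_sym _ v) !n_comb.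
  rewrite (n_sym (S g) (P g)) /D.
  have : 0 <= l0 * n (S g) g by rewrite mulr_ge0.
  lra.
have vv : n v v <= 4 * K * n g g.
  have := n_ge0 (comb (P g) (-1) (S g)); rewrite /v !expand.
  by have := P_bnd g; have := S_bnd g; lra.
have hv : 2 * n h v <= r * n h h + n v v / r.
  have := n_ge0 (comb v (- r) h); rewrite expand (n_sym v h) => H.
  rewrite -(ler_pM2r rp) [leRHS]mulrDl divfK ?gt_eqF //; lra.
have vr : n v v / r <= 4 * K / r * n g g.
  by rewrite ler_pdivrMr // mulrAC divfK ?gt_eqF.
have rH : r * n h h <= r * (C * Q) by rewrite ler_wpM2l // ltW.
rewrite /l1 mulrAC ler_pdivlMr //; rewrite /Q in rH; lra.
Qed.

End LoewnerHeinz.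

(** * Measurability over the subalgebra and the pull-out property *)

Section Pullout.
Context {R : realType} {d : measure_display} {X : measurableType d}.
Variables (mu : {measure set X -> \bar R}) (A : set (set X)).
Hypotheses (sA : sigma_algebra setT A) (subA : A `<=` measurable).
Local Notation XA := (g_sigma_algebraType A).

(** Phrased on the type that carries A as its sigma-algebra, so that the closure lemmas for
    measurable functions apply directly, for real and extended values alike. *)
Definition sub_measurable d' (Y : measurableType d') (g : X -> Y) :=
  measurable_fun [set: XA] (g : XA -> Y).

Lemma measurable_subE (B : set X) : (measurable (B : set XA)) = A B.
Proof. by rewrite measurable_g_measurableTypeE. Qed.

Lemma sub_measurableW d' (Y : measurableType d') (g : X -> Y) :
  sub_measurable g -> measurable_fun setT g.
Proof.
move=> mg _ B mB; apply: subA; rewrite -measurable_subE.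
exact: mg.
Qed.

Lemma A_measurableP (g : X -> \bar R) : A_measurable A g <-> sub_measurable g.
Proof.
split=> [mg _ B mB|mg B mB].
  by rewrite setTI measurable_subE; exact: mg.
by rewrite -measurable_subE -[X in measurable X]setTI; exact: mg.
Qed.

(** The factor c may be infinite. The indeterminate product 0 * oo does no harm, because k = 0
    forces every [h n] to be 0. *)
Lemma cvgeM_monotone (h : nat -> R) (k c : \bar R) :
  (forall n, 0 <= h n) -> (forall n, ((h n)%:E <= k)%E) ->
  (EFin \o h) n @[n --> \oo] --> k ->
  ((h n)%:E * c)%E @[n --> \oo] --> (k * c)%E.
Proof.
move=> h0 hk cvh.
have [k0|k0] := eqVneq k 0%E.
  have hz n : h n = 0.
    by apply/eqP; rewrite eq_le h0 andbT -lee_fin -[X in (_ <= X)%E]k0.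
  rewrite k0 mul0e; under eq_fun do rewrite hz mul0e.
  exact: cvg_cst.
have [->|c0] := eqVneq c 0%E.
  by rewrite mule0; under eq_fun do rewrite mule0; exact: cvg_cst.
apply: (@cvgeM _ _ _ _ (EFin \o h) (cst c)) => //; last exact: cvg_cst.
by apply: neq0_mule_def; rewrite mule_eq0 negb_or k0.
Qed.

Import HBNNSimple.

(** The level sets of h belong to A, and over each of them f and g have the same integral. *)
Lemma condexp_nonneg_pullout_nnsfun (f g : X -> \bar R) (h : {nnsfun XA >-> R}) :
  measurable_fun setT f -> (forall x, 0 <= f x)%E ->
  condexp_nonneg mu A f g ->
  (\int[mu]_x ((h x)%:E * f x) = \int[mu]_x ((h x)%:E * g x))%E.
Proof.
move=> mf f0 [/A_measurableP mg g0 fg].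
have mgX := sub_measurableW mg.
have mpre r : A (h @^-1` [set r]).
  rewrite -measurable_subE -[X in measurable X]setTI.
  exact: (@measurable_funP _ _ _ _ _ h).
have preM r : measurable (h @^-1` [set r] : set X) by apply: subA; exact: mpre.
have aux (k : X -> \bar R) : measurable_fun setT k -> (forall x, 0 <= k x)%E ->
  (\int[mu]_x ((h x)%:E * k x) =
   \sum_(r \in range h) (r%:E * \int[mu]_(x in h @^-1` [set r]) k x))%E.
  move=> mk k0.
  have hge0 r (x : X) : range h r ->
      (0 <= r%:E * (\1_(h @^-1` [set r] : set X) x)%:E)%E.
    by move=> [t _ <-]; rewrite mule_ge0 ?lee_fin.
  transitivity (\int[mu]_x (\sum_(r \in range h)
      (r * \1_(h @^-1` [set r] : set X) x)%:E * k x))%E.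
    apply: eq_integral => x _.
    rewrite -ge0_mule_fsuml => [|r]; last exact: nnfun_muleindic_ge0.
    by rewrite fsumEFin // -(fimfunE h x).
  rewrite ge0_integral_fsum//.
  - apply: eq_fsbigr => r; rewrite inE => -[t _ rE].
    under eq_integral do rewrite EFinM -muleA.
    rewrite ge0_integralZl//; last 3 first.
    + apply: emeasurable_funM => //; apply/measurable_EFinP.
      exact: measurable_indic.
    + by move=> x _; rewrite mule_ge0 // lee_fin.
    + by rewrite lee_fin -rE.
    congr (_ * _)%E.
    rewrite [RHS]integral_mkcond; apply: eq_integral => x _.
    by rewrite epatch_indic muleC.
  - move=> r; apply: emeasurable_funM => //; apply/measurable_EFinP.
    apply: measurable_funM => //; exact: measurable_indic.
  - by move=> r x _; rewrite mule_ge0//; exact: nnfun_muleindic_ge0.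
rewrite aux // aux //; apply: eq_fsbigr => r _.
by rewrite fg.
Qed.

(** Monotone convergence along simple functions built on A. The identity is one between possibly
    infinite integrals, and g and k may take the value +oo. *)
Lemma condexp_nonneg_pullout (f g k : X -> \bar R) :
  measurable_fun setT f -> (forall x, 0 <= f x)%E ->
  condexp_nonneg mu A f g ->
  sub_measurable k -> (forall x, 0 <= k x)%E ->
  (\int[mu]_x (k x * f x) = \int[mu]_x (k x * g x))%E.
Proof.
move=> mf f0 fg mk k0.
have [/A_measurableP /sub_measurableW mg g0 _] := fg.
pose h := nnsfun_approx (@measurableT _ XA) (mk : measurable_fun setT (k : XA -> _)).
have hk n x : ((h n x)%:E <= k x)%E.
  by rewrite /h nnsfun_approxE; exact: le_approx.
have cvh x : (EFin \o h ^~ x) n @[n --> \oo] --> k x.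
  by apply: cvg_nnsfun_approx => //.
have aux (c : X -> \bar R) : measurable_fun setT c -> (forall x, 0 <= c x)%E ->
    (\int[mu]_x (k x * c x) = limn (fun n => \int[mu]_x ((h n x)%:E * c x)))%E.
  move=> mc c0; rewrite -monotone_convergence //.
  - apply: eq_integral => x _; apply/esym/cvg_lim => //.
    by apply: cvgeM_monotone.
  - move=> n; apply: emeasurable_funM => //; apply/measurable_EFinP.
    by apply: sub_measurableW; exact: (@measurable_funP _ _ _ _ _ (h n)).
  - by move=> n x _; rewrite mule_ge0 // lee_fin.
  - move=> x _ a b ab; rewrite lee_wpmul2r // lee_fin.
    by have /lefP := nd_nnsfun_approx (@measurableT _ XA) (mk : measurable_fun setT (k : XA -> _)) ab; apply.
rewrite aux // aux //; congr (limn _); apply/funext => n.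
exact: condexp_nonneg_pullout_nnsfun.
Qed.
End Pullout.

(** * Existence of conditional expectations by Radon-Nikodym *)

(** Sigma-finiteness, finiteness and absolute continuity come as propositions; the set functions are
    packed into the structures over which the Radon-Nikodym theorem is stated. *)
Lemma radon_nikodym_measure d (T : measurableType d) (R : realType)
    (m : {measure set T -> \bar R}) (n : set T -> \bar R) :
  sigma_finite setT m -> n set0 = 0%E -> (forall B, 0 <= n B)%E ->
  semi_sigma_additive n -> fin_num_fun n ->
  (forall B, measurable B -> m B = 0%E -> n B = 0%E) ->
  exists f : T -> \bar R, [/\ forall x, (0 <= f x)%E, measurable_fun setT f &
    forall B, measurable B -> n B = (\int[m]_(x in B) f x)%E].
Proof.
move=> sm n0 nge0 nsa nfin nm.
pose M : {sigma_finite_measure set T -> \bar R} :=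
  HB.pack_for {sigma_finite_measure set T -> \bar R} (Measure.sort m)
    (isSFinite.Build _ _ _ (m : set T -> \bar R) (sfinite_measure_sigma_finite sm))
    (isSigmaFinite.Build _ _ _ (m : set T -> \bar R) sm).
pose N0 := isMeasure.Build _ _ _ n n0 nge0 nsa.
pose N1 : {measure set T -> \bar R} := HB.pack_for {measure set T -> \bar R} n N0.
have nsf : sigma_finite setT n.
  by apply: fin_num_fun_sigma_finite => //; rewrite n0.
pose N : {finite_measure set T -> \bar R} :=
  HB.pack_for {finite_measure set T -> \bar R} (Measure.sort N1)
    (isSFinite.Build _ _ _ (N1 : set T -> \bar R) (sfinite_measure_sigma_finite (mu := N1) nsf))
    (isSigmaFinite.Build _ _ _ (N1 : set T -> \bar R) nsf)
    (isFinite.Build _ _ _ (N1 : set T -> \bar R) nfin).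
have dom : N `<< M.
  by apply/null_content_dominatesP => B mB MB0; exact: nm.
have [f [f0 ffin fint fE]] := radon_nikodym_sigma_finite dom.
exists f; split=> //.
exact: measurable_int fint.
Qed.

Section Existence.
Context {R : realType} {d : measure_display} {X : measurableType d}.
Variables (mu : {measure set X -> \bar R}) (A : set (set X)).
Hypotheses (sA : sigma_algebra setT A) (subA : A `<=` measurable).
Local Notation XA := (g_sigma_algebraType A).

Let idA : X -> XA := idfun.
Let midA : measurable_fun setT idA.
Proof. by move=> _ B mB; rewrite setTI; apply: subA; rewrite -(measurable_subE sA). Qed.

(** The restriction of mu to A, as push-forward along the identity from Sigma to A. *)
Let muA : {measure set XA -> \bar R} :=
  measure_function_pushforward__canonical__measure_function_Measure mu midA.

Let integral_muA (B : set X) (g : X -> \bar R) : A B -> sub_measurable A g ->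
  (forall x, 0 <= g x)%E ->
  (\int[muA]_(x in (B : set XA)) g x = \int[mu]_(x in B) g x)%E.
Proof.
move=> AB mg g0; rewrite ge0_integral_pushforward //.
- by rewrite (measurable_subE sA).
- exact: measurable_funTS.
Qed.

(** The measure B |-> \int_B h need not be sigma-finite on A. So X is cut into disjoint pieces
    [D i], measurable for Sigma only, over which h has finite integral; each B |-> \int_(B [&] D i)
    h is a finite measure on A, and the densities are summed, possibly to +oo. *)
Lemma condexp_nonneg_exists (h : X -> R) :
  sub_sigma_finite mu A -> measurable_fun setT h -> (forall x, 0 <= h x) ->
  exists g, condexp_nonneg mu A (EFin \o h) g.
Proof.
move=> [_ _ [F0 F0T F0A]] mh h0.
have sfin : sigma_finite setT muA.
  exists F0 => // i; have [AF muF] := F0A i; split => //.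
  by rewrite (measurable_subE sA).
have [F [FT ndF Ffin]] : exists F : nat -> set X,
    [/\ setT = \bigcup_i F i, nondecreasing_seq F &
    forall i, A (F i) /\ (mu (F i) < +oo)%E].
  have /sigma_finiteP [F [FT ndF Ffin]] := sfin; exists F; split=> // i.
  by have [mF muF] := Ffin i; split => //; rewrite -(measurable_subE sA).
have mF i : measurable (F i) by apply: subA; exact: (Ffin i).1.
have muF i := (Ffin i).2.
have mle (n : nat) : measurable [set x | h x <= n%:R].
  by rewrite -[X in measurable X]setTI; apply: measurable_fun_le.
pose G n := F n `&` [set x | h x <= n%:R].
have mG n : measurable (G n) by apply: measurableI.
pose D := seqDU G.
have mD n : measurable (D n) by apply: measurableD => //; exact: bigsetU_measurable.
have DT : \bigcup_n D n = setT.
  rewrite -seqDU_bigcup_eq; apply/seteqP; split => // x _.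
  have [i _ Fix] : (\bigcup_i F i) x by rewrite -FT.
  have [m hm] : exists m : nat, h x <= m%:R.
    by exists (Num.truncn (h x)).+1; apply: ltW; exact: truncnS_gt.
  exists (maxn i m) => //; split => /=.
    by have /subsetPset := ndF _ _ (leq_maxl i m); apply.
  by apply: le_trans hm _; rewrite ler_nat leq_maxr.
pose f := EFin \o h.
have f0 x : (0 <= f x)%E by rewrite lee_fin.
have mf : measurable_fun setT f by apply/measurable_EFinP.
pose n_ i (B : set XA) := (\int[mu]_(x in (B : set X) `&` D i) f x)%E.
have nlt i (B : set X) : measurable B -> (n_ i B < +oo)%E.
  move=> mB.
  have h1 : (\int[mu]_(x in B `&` D i) f x <= \int[mu]_(x in G i) f x)%E.
    apply: ge0_subset_integral => //.
    - exact: measurableI.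
    - exact: measurable_funTS.
    - by move=> x [_ [Gx _]].
  apply: le_lt_trans h1 _.
  have h2 : (\int[mu]_(x in G i) f x <= \int[mu]_(x in G i) (cst (i%:R)%:E) x)%E.
    apply: ge0_le_integral => //; first exact: measurable_funTS.
    by move=> x [_ /=]; rewrite lee_fin.
  apply: le_lt_trans h2 _; rewrite integral_cst //.
  apply: lte_mul_pinfty => //; apply: le_lt_trans (muF i).
  by apply: le_measure; rewrite ?inE // => x [].
have RN i : exists g : X -> \bar R, [/\ forall x, (0 <= g x)%E, sub_measurable A g &
    forall B, A B -> (\int[mu]_(x in B `&` D i) f x = \int[mu]_(x in B) g x)%E].
  have [||||||g [g0 mg gE]] := @radon_nikodym_measure _ XA R muA (n_ i).
  - exact: sfin.
  - by rewrite /n_ set0I integral_set0.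
  - by move=> B; apply: integral_ge0.
  - move=> B mB tB mUB; rewrite /n_ setI_bigcupl ge0_integral_bigcup //.
    + by apply: is_cvg_ereal_nneg_natsum_cond => n _ _; exact: integral_ge0.
    + move=> k; apply: measurableI => //; apply: subA; rewrite -(measurable_subE sA); exact: mB.
    + exact: measurable_funTS.
    + exact: trivIset_setIr.
  - move=> B; rewrite (measurable_subE sA) // => AB.
    rewrite ge0_fin_numE ?integral_ge0 //; apply: nlt; exact: subA.
  - move=> B; rewrite (measurable_subE sA) // => AB muB; rewrite /n_.
    have mB := subA AB.
    apply: null_set_integral.
    + exact: measurableI.
    + exact: measurable_funTS.
    + by apply: (@subset_measure0 _ _ _ mu _ B) => //; exact: measurableI.
  exists g; split => // B AB.
  rewrite -(integral_muA AB mg g0) -gE //.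
  by rewrite (measurable_subE sA).
have [g /all_and3 [g0 mg gE]] := choice RN.
exists (fun x => \sum_(0 <= i <oo) g i x)%E; split.
- apply/A_measurableP => //.
  apply: (@ge0_emeasurable_sum _ XA) => // n _; exact: mg.
- by move=> x; apply: nneseries_ge0 => n _ _; exact: g0.
move=> B AB; have mB := subA AB.
rewrite integral_nneseries //; last by move=> n; apply: measurable_funTS; exact: sub_measurableW (mg n).
under [RHS]eq_eseriesr do rewrite -gE //.
rewrite -[in LHS](setIT B) -DT setI_bigcupr ge0_integral_bigcup //.
- by move=> k; exact: measurableI.
- exact: measurable_funTS.
- by apply: trivIset_setIl; exact: trivIset_seqDU.
Qed.

End Existence.

(** * Integrable and square-integrable real functions *)

Section RealIntegrals.
Context {R : realType} {d : measure_display} {X : measurableType d}.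
Variable mu : {measure set X -> \bar R}.
Implicit Types f g h k : X -> R.

Definition integrableR f := mu.-integrable setT (fun x => (f x)%:E).

Lemma integrableR_measurable f : integrableR f -> measurable_fun setT f.
Proof. by move=> /(measurable_int mu) /measurable_EFinP. Qed.

Lemma integrableR_le f g : measurable_fun setT f ->
  (forall x, `|f x| <= g x) -> integrableR g -> integrableR f.
Proof.
move=> mf fg; apply: le_integrable => //; first exact/measurable_EFinP.
by move=> x _; rewrite /= lee_fin (le_trans (fg x)) // ler_norm.
Qed.

Lemma integrableR_D f g : integrableR f -> integrableR g ->
  integrableR (fun x => f x + g x).
Proof.
move=> f1 g1; have := integrableD measurableT f1 g1.
by apply: eq_integrable.
Qed.

Lemma integrableR_B f g : integrableR f -> integrableR g ->
  integrableR (fun x => f x - g x).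
Proof.
move=> f1 g1; have := integrableB measurableT f1 g1.
by apply: eq_integrable.
Qed.

Lemma integrableR_Z (c : R) f : integrableR f -> integrableR (fun x => c * f x).
Proof.
move=> f1; have := integrableZl measurableT c f1.
by apply: eq_integrable.
Qed.

Lemma integrableR_ge0 f : measurable_fun setT f -> (forall x, 0 <= f x) ->
  (\int[mu]_x (f x)%:E < +oo)%E -> integrableR f.
Proof.
move=> mf f0 flt; apply/integrableP; split; first exact/measurable_EFinP.
by under eq_integral do rewrite gee0_abs ?lee_fin //.
Qed.

Lemma integrableR_fin f : integrableR f ->
  (\int[mu]_x f x)%:E = (\int[mu]_x (f x)%:E)%E.
Proof. by move=> f1; rewrite fineK // integrable_fin_num. Qed.

Lemma ae_eq_Rintegral f g : measurable_fun setT f -> measurable_fun setT g ->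
  {ae mu, forall x, f x = g x} -> \int[mu]_x f x = \int[mu]_x g x.
Proof.
move=> mf mg fg; rewrite /Rintegral; congr fine.
apply: ae_eq_integral => //; [exact/measurable_EFinP|exact/measurable_EFinP|].
by apply: filterS fg => x fg _; rewrite fg.
Qed.

Lemma ae_eq_integrableR f g : measurable_fun setT g ->
  {ae mu, forall x, f x = g x} -> integrableR f -> integrableR g.
Proof.
move=> mg fg f1; have mf := integrableR_measurable f1.
have /integrableP [_ flt] := f1.
apply/integrableP; split; first exact/measurable_EFinP.
rewrite (ge0_ae_eq_integral (g := fun x => `|(f x)%:E|%E)) //.
- by apply/measurable_EFinP; apply: measurableT_comp.
- by apply/measurable_EFinP; apply: measurableT_comp.
- by apply: filterS fg => x fg _; rewrite fg.
Qed.

Definition sq_integrable f :=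
  measurable_fun setT f /\ integrableR (fun x => f x ^+ 2).

Lemma sq_integrable_mul f g : sq_integrable f -> sq_integrable g ->
  integrableR (fun x => f x * g x).
Proof.
move=> [mf f2] [mg g2]; apply: integrableR_le (integrableR_D f2 g2).
  exact: measurable_funM.
move=> x; rewrite normrM -(real_normK (num_real (f x))) -(real_normK (num_real (g x))).
have := sqr_ge0 (`|f x| - `|g x|).
have := normr_ge0 (f x); have := normr_ge0 (g x).
by set a := `|f x|; set b := `|g x|; nra.
Qed.

Lemma sq_integrable_le f g : measurable_fun setT f ->
  (forall x, f x ^+ 2 <= g x ^+ 2) -> sq_integrable g -> sq_integrable f.
Proof.
move=> mf fg [mg g2]; split=> //; apply: integrableR_le g2.
  exact: measurable_funX.
by move=> x; rewrite ger0_norm ?sqr_ge0.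
Qed.

Lemma sq_integrableD f g : sq_integrable f -> sq_integrable g ->
  sq_integrable (fun x => f x + g x).
Proof.
move=> [mf f2] [mg g2]; split; first exact: measurable_funD.
apply: integrableR_le (integrableR_Z 2 (integrableR_D f2 g2)).
  by apply: measurable_funX; exact: measurable_funD.
move=> x; rewrite ger0_norm ?sqr_ge0 //.
by have := sqr_ge0 (f x - g x); nra.
Qed.

Lemma sq_integrableZ (c : R) f : sq_integrable f ->
  sq_integrable (fun x => c * f x).
Proof.
move=> [mf f2]; split; first exact: measurable_funM.
apply: integrableR_le (integrableR_Z (c ^+ 2) f2).
  by apply: measurable_funX; exact: measurable_funM.
by move=> x; rewrite exprMn ger0_norm // mulr_ge0 ?sqr_ge0.
Qed.

Lemma sq_integrableN f : sq_integrable f -> sq_integrable (fun x => - f x).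
Proof.
move=> f2; apply: (sq_integrable_le _ _ f2) => [|x]; last by rewrite sqrrN.
by apply: measurable_funN; exact: f2.1.
Qed.

End RealIntegrals.

(** * Real conditional expectation defined by testing *)

Section CondExp.
Context {R : realType} {d : measure_display} {X : measurableType d}.
Variables (mu : {measure set X -> \bar R}) (A : set (set X)).
Hypotheses (sA : sigma_algebra setT A) (subA : A `<=` measurable).
Implicit Types f g h k : X -> R.
Local Notation XA := (g_sigma_algebraType A).
Local Notation Am := (sub_measurable A).

Let Am_measurable k : Am k -> measurable_fun setT k.
Proof. exact: sub_measurableW. Qed.

(* [h] itself need not be integrable, not even locally: where [E|h|] is infinite,
   the value of [g] is arbitrary and no admissible [k] sees it. *)
Definition has_condexp h g :=
  [/\ measurable_fun setT h, Am g &
      forall k, Am k -> integrableR mu (fun x => k x * h x) ->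
        integrableR mu (fun x => k x * g x) /\
        \int[mu]_x (k x * h x) = \int[mu]_x (k x * g x)].

Lemma sub_measurableM f g : Am f -> Am g -> Am (fun x => f x * g x).
Proof. by move=> mf mg; exact: (@measurable_funM _ XA). Qed.

Lemma sub_measurableD f g : Am f -> Am g -> Am (fun x => f x + g x).
Proof. by move=> mf mg; exact: (@measurable_funD _ XA). Qed.

Lemma sub_measurableB f g : Am f -> Am g -> Am (fun x => f x - g x).
Proof. by move=> mf mg; exact: (@measurable_funB _ XA). Qed.

Lemma sub_measurable_posp f : Am f -> Am (fun x => posp (f x)).
Proof. by move=> mf; apply: (@measurable_maxr _ XA) => //; exact: measurable_cst. Qed.

Lemma sub_measurable_negp f : Am f -> Am (fun x => negp (f x)).
Proof.
move=> mf; apply: (@measurable_maxr _ XA); last exact: measurable_cst.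
exact: (@measurable_funN _ XA).
Qed.

Lemma measurable_fun_negp f : measurable_fun setT f ->
  measurable_fun setT (fun x => negp (f x)).
Proof. by move=> mf; apply: measurable_maxr => //; exact: measurable_funN. Qed.

Lemma measurable_fun_posp f : measurable_fun setT f ->
  measurable_fun setT (fun x => posp (f x)).
Proof. by move=> mf; apply: measurable_maxr. Qed.

Lemma pospBnegp (r : R) : posp r - negp r = r.
Proof. by rewrite /posp /negp; case: (leP r 0); case: (leP (-r) 0); lra. Qed.

Lemma posp_ge0 (r : R) : 0 <= posp r.
Proof. by rewrite /posp le_max lexx orbT. Qed.

Lemma negp_ge0 (r : R) : 0 <= negp r.
Proof. by rewrite /negp le_max lexx orbT. Qed.

Lemma posp_le (r : R) : posp r <= `|r|.
Proof. by rewrite /posp ge_max ler_norm normr_ge0. Qed.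

Lemma negp_le (r : R) : negp r <= `|r|.
Proof. by rewrite /negp ge_max normr_ge0 -normrN ler_norm. Qed.

(** A test function of either sign is split into [posp] and [negp], so that the nonnegative pull-out
    applies to each part. *)
Lemma has_condexp_nonneg h (a : X -> \bar R) :
  measurable_fun setT h -> (forall x, 0 <= h x) ->
  condexp_nonneg mu A (fun x => (h x)%:E) a ->
  has_condexp h (fun x => fine (a x)).
Proof.
move=> mh h0 ha; have [/(A_measurableP sA) ma a0 _] := ha.
have mha : Am (fun x => fine (a x)).
  by apply: (@measurableT_comp _ _ _ XA) => //.
split=> // k mk kh.
have mkh := integrableR_measurable kh.
have pos (p : X -> R) : Am p -> (forall x, 0 <= p x) ->
    integrableR mu (fun x => p x * h x) ->
    integrableR mu (fun x => p x * fine (a x)) /\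
    \int[mu]_x (p x * h x) = \int[mu]_x (p x * fine (a x)).
  move=> mp p0 ph.
  have mpe : Am (fun x => (p x)%:E) by apply/measurable_EFinP.
  have E : (\int[mu]_x ((p x)%:E * (h x)%:E) = \int[mu]_x ((p x)%:E * a x))%E.
    apply: (condexp_nonneg_pullout sA subA _ _ ha mpe) => //.
    exact/measurable_EFinP.
  have mpa : measurable_fun setT (fun x => (p x)%:E * a x)%E.
    apply: emeasurable_funM; first exact: sub_measurableW mpe.
    exact: sub_measurableW ma.
  have pa0 x : (0 <= (p x)%:E * a x)%E by rewrite mule_ge0 // lee_fin.
  have paint : mu.-integrable setT (fun x => (p x)%:E * a x)%E.
    apply/integrableP; split => //.
    under eq_integral do rewrite gee0_abs //.
    by rewrite -E; exact: integrable_lty ph.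
  (* Replacing a by [fine (a x)] costs nothing: where p > 0, integrability of p * a excludes a =
     +oo, and where p = 0 both products are 0. *)
  have fin : {ae mu, forall x, ((p x)%:E * a x)%E = (p x * fine (a x))%:E}.
    apply: filterS (integrable_ae measurableT paint) => x /(_ I).
    have [p00|p00] := eqVneq (p x) 0; first by rewrite p00 mul0e mul0r.
    have := a0 x; case: (a x) => [r|//|//] _ //=.
    by rewrite mulr_infty gtr0_sg ?lt_neqAle ?p0 1?eq_sym ?p00 // mul1e.
  have mpf : measurable_fun setT (fun x => p x * fine (a x)).
    by apply: Am_measurable; exact: sub_measurableM.
  have pf : integrableR mu (fun x => p x * fine (a x)).
    apply: integrableR_ge0 => //; first by move=> x; rewrite mulr_ge0 ?fine_ge0.
    rewrite -(ge0_ae_eq_integral (f := fun x => ((p x)%:E * a x)%E)) //.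
    + exact: integrable_lty.
    + exact/measurable_EFinP.
    + by move=> x _; rewrite lee_fin mulr_ge0 ?fine_ge0.
    + by apply: filterS fin => x ->.
  split => //; rewrite /Rintegral; congr fine.
  rewrite [LHS]E; apply: ge0_ae_eq_integral => //.
  + exact/measurable_EFinP.
  + by move=> x _; rewrite lee_fin mulr_ge0 ?fine_ge0.
  + by apply: filterS fin => x ->.
have ph : integrableR mu (fun x => posp (k x) * h x).
  apply: integrableR_le (integrable_norm kh).
    by apply: measurable_funM => //; apply: measurable_fun_posp; exact: Am_measurable.
  by move=> x; rewrite /= !normrM ler_wpM2r // (ger0_norm (posp_ge0 _)) posp_le.
have nh : integrableR mu (fun x => negp (k x) * h x).
  apply: integrableR_le (integrable_norm kh).
    by apply: measurable_funM => //; apply: measurable_fun_negp; exact: Am_measurable.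
  by move=> x; rewrite /= !normrM ler_wpM2r // (ger0_norm (negp_ge0 _)) negp_le.
have [pa pE] := pos _ (sub_measurable_posp mk) (fun x => posp_ge0 _) ph.
have [na nE] := pos _ (sub_measurable_negp mk) (fun x => negp_ge0 _) nh.
have split_ (f : X -> R) : (fun x => k x * f x) =
    (fun x => posp (k x) * f x - negp (k x) * f x).
  by apply/funext => x; rewrite -mulrBl pospBnegp.
rewrite !split_; split; first exact: integrableR_B.
by rewrite !RintegralB // pE nE.
Qed.

(** The two dominations exclude cancellation: k h1 and k h2 are integrable as soon as k (h1 - h2)
    is. They hold for the positive and negative parts of one function. *)
Lemma has_condexp_sub h1 h2 g1 g2 : has_condexp h1 g1 -> has_condexp h2 g2 ->
  (forall x, `|h1 x| <= `|h1 x - h2 x|) -> (forall x, `|h2 x| <= `|h1 x - h2 x|) ->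
  has_condexp (fun x => h1 x - h2 x) (fun x => g1 x - g2 x).
Proof.
move=> [mh1 mg1 E1] [mh2 mg2 E2] l1 l2; split.
- exact: measurable_funB.
- exact: sub_measurableB.
move=> k mk kh.
have mkX := Am_measurable mk.
have k1 : integrableR mu (fun x => k x * h1 x).
  apply: integrableR_le (integrable_norm kh); first exact: measurable_funM.
  by move=> x; rewrite /= !normrM ler_wpM2l.
have k2 : integrableR mu (fun x => k x * h2 x).
  apply: integrableR_le (integrable_norm kh); first exact: measurable_funM.
  by move=> x; rewrite /= !normrM ler_wpM2l.
have [i1 e1] := E1 _ mk k1; have [i2 e2] := E2 _ mk k2.
have split_ (f g : X -> R) : (fun x => k x * (f x - g x)) =
    (fun x => k x * f x - k x * g x) by apply/funext => x; rewrite mulrBr.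
rewrite !split_; split; first exact: integrableR_B.
by rewrite !RintegralB // e1 e2.
Qed.

Lemma has_condexp_scale (c h g : X -> R) : Am c -> has_condexp h g ->
  has_condexp (fun x => c x * h x) (fun x => c x * g x).
Proof.
move=> mc [mh mg E]; split.
- by apply: measurable_funM => //; exact: Am_measurable.
- exact: sub_measurableM.
move=> k mk; have assoc (f : X -> R) :
    (fun x => k x * (c x * f x)) = (fun x => (k x * c x) * f x).
  by apply/funext => x; rewrite mulrA.
by rewrite !assoc; apply: E; exact: sub_measurableM.
Qed.

Lemma condexp_components (f g : X -> R[i]) : cmeasurable f -> condexp mu A f g ->
  has_condexp (fun x => complex.Re (f x)) (fun x => complex.Re (g x)) /\
  has_condexp (fun x => complex.Im (f x)) (fun x => complex.Im (g x)).
Proof.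
move=> [mf1 mf2] [a [b [c [e [ha hb hc he ->]]]]].
have aux (r : X -> R) (p q : X -> \bar R) : measurable_fun setT r ->
    condexp_nonneg mu A (fun x => (posp (r x))%:E) p ->
    condexp_nonneg mu A (fun x => (negp (r x))%:E) q ->
    has_condexp r (fun x => fine (p x) - fine (q x)).
  move=> mr hp hq; rewrite (_ : r = fun x => posp (r x) - negp (r x)); last first.
    by apply/funext => x; rewrite pospBnegp.
  apply: has_condexp_sub.
  - apply: has_condexp_nonneg => //; first exact: measurable_fun_posp.
    by move=> x; exact: posp_ge0.
  - apply: has_condexp_nonneg => //; first exact: measurable_fun_negp.
    by move=> x; exact: negp_ge0.
  - by move=> x; rewrite pospBnegp (ger0_norm (posp_ge0 _)) posp_le.
  - by move=> x; rewrite pospBnegp (ger0_norm (negp_ge0 _)) negp_le.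
by split; apply: aux.
Qed.

Lemma condexp_exists (f : X -> R[i]) : sub_sigma_finite mu A -> cmeasurable f ->
  exists g : X -> R[i], condexp mu A f g.
Proof.
move=> sf [m1 m2].
have [a ha] := condexp_nonneg_exists sA subA sf (measurable_fun_posp m1) (fun x => posp_ge0 _).
have [b hb] := condexp_nonneg_exists sA subA sf (measurable_fun_negp m1) (fun x => negp_ge0 _).
have [c hc] := condexp_nonneg_exists sA subA sf (measurable_fun_posp m2) (fun x => posp_ge0 _).
have [e he] := condexp_nonneg_exists sA subA sf (measurable_fun_negp m2) (fun x => negp_ge0 _).
by eexists; exists a, b, c, e; split.
Qed.

End CondExp.

(** * Truncations as test functions and duality criteria *)

Section Truncation.
Context {R : realType} {d : measure_display} {X : measurableType d}.
Variables (mu : {measure set X -> \bar R}) (A : set (set X)).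
Hypotheses (sf : sub_sigma_finite mu A).
Implicit Types f g h k z : X -> R.
Local Notation XA := (g_sigma_algebraType A).
Local Notation Am := (sub_measurable A).

Let sA : sigma_algebra setT A. Proof. by case: sf. Qed.
Let subA : A `<=` measurable. Proof. by case: sf. Qed.
Let Am_measurable k : Am k -> measurable_fun setT k.
Proof. exact: sub_measurableW. Qed.

Lemma sub_exhaustion : exists F : nat -> set X,
  [/\ forall i, A (F i), forall i, (mu (F i) < +oo)%E,
      nondecreasing_seq F & \bigcup_i F i = setT].
Proof.
have [_ _ [F FT AF]] := sf.
pose G n := \big[setU/set0]_(i < n.+1) F i.
exists G; split.
- move=> n; rewrite -(measurable_subE sA).
  apply: (@bigsetU_measurable _ XA) => i _.
  by rewrite (measurable_subE sA); exact: (AF i).1.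
- move=> n; rewrite /G.
  have mF i : measurable (F i) by apply: subA; exact: (AF i).1.
  apply: (@le_lt_trans _ _ (\sum_(i < n.+1) mu (F i))%E).
    exact: Boole_inequality.
  by apply: lte_sum_pinfty => i _; exact: (AF i).2.
- by move=> m k mk; apply/subsetPset; exact: subset_bigsetU.
- by rewrite FT -(bigcup_bigsetU_bigcup F).
Qed.

(** z is multiplied by indicators of increasing sets of A of finite measure on which |z| <= n. Since
    each value is z or 0, [t n] times z is the square of [t n], which makes [t n] a test function
    for z itself. *)
Lemma truncation_exists z : Am z -> exists t : nat -> X -> R,
  [/\ forall n, Am (t n), forall n, sq_integrable mu (t n),
      forall n x, t n x = z x \/ t n x = 0,
      forall x, exists n, t n x = z x &
      forall m n x, (m <= n)%N -> t m x ^+ 2 <= t n x ^+ 2].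
Proof.
move=> mz; have [F [AF muF ndF FT]] := sub_exhaustion.
pose G n := F n `&` [set x | `|z x| <= n%:R].
have AG n : A (G n).
  rewrite -(measurable_subE sA); apply: (@measurableI _ XA).
    by rewrite (measurable_subE sA).
  rewrite -[X in measurable X]setTI.
  apply: (@measurable_fun_le _ XA) => //.
  exact: (@measurableT_comp _ _ _ XA).
have mG n : measurable (G n) by exact: subA.
have muG n : (mu (G n) < +oo)%E.
  apply: le_lt_trans (muF n); apply: le_measure; rewrite ?inE //; last by move=> x [].
  exact: subA.
have ndG m n : (m <= n)%N -> G m `<=` G n.
  move=> mn x [Fx zx]; split.
    by have /subsetPset := ndF _ _ mn; apply.
  by apply: le_trans zx _; rewrite ler_nat.
exists (fun n x => \1_(G n) x * z x).
have mt n : Am (fun x => \1_(G n) x * z x).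
  apply: sub_measurableM => //; apply: (@measurable_indic _ XA).
  by rewrite (measurable_subE sA).
split => //.
- move=> n; have mtX := Am_measurable (mt n); split=> //.
  apply: (@integrableR_le _ _ _ _ _ (fun x => n%:R ^+ 2 * \1_(G n) x)).
  + exact: measurable_funX.
  + move=> x; rewrite ger0_norm ?sqr_ge0 // exprMn.
    rewrite !indicE; case: (boolP (x \in G n)) => xG; last by rewrite expr0n /= mul0r mulr0.
    move: xG; rewrite inE => -[_ /= zn].
    by rewrite expr1n mul1r mulr1 -(real_normK (num_real (z x))) lerXn2r ?nnegrE.
  + apply: integrableR_Z; apply: integrableR_ge0 => //.
    by rewrite integral_indic // setIT.
- move=> n x; rewrite indicE; case: (x \in G n); [left|right]; by rewrite ?mul1r ?mul0r.
- move=> x; have [i _ Fix] : (\bigcup_i F i) x by rewrite FT.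
  pose m := (Num.truncn `|z x|).+1.
  have zm : `|z x| <= m%:R by apply: ltW; exact: truncnS_gt.
  exists (maxn i m); rewrite indicE mem_set ?mul1r //; split => /=.
    by have /subsetPset := ndF _ _ (leq_maxl i m); apply.
  by apply: le_trans zm _; rewrite ler_nat leq_maxr.
- move=> m n x mn; rewrite !exprMn ler_wpM2r ?sqr_ge0 //.
  rewrite !indicE; case: (boolP (x \in G m)) => xG.
    by rewrite (mem_set (ndG _ _ mn _ (set_mem xG))).
  by rewrite expr0n sqr_ge0.
Qed.

(** The choice k = [t n] gives integral 0 to the square of every truncation of z. *)
Lemma ae_eq0_duality z : Am z ->
  (forall k, Am k -> sq_integrable mu k -> integrableR mu (fun x => k x * z x) ->
    \int[mu]_x (k x * z x) = 0) ->
  {ae mu, forall x, z x = 0}.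
Proof.
move=> mz orth; have [t [mt st tz tev _]] := truncation_exists mz.
have tn n : {ae mu, forall x, t n x = 0}.
  have E : (fun x => t n x * z x) = (fun x => t n x ^+ 2).
    by apply/funext => x; have [->|->] := tz n x; rewrite expr2 ?mul0r.
  have i2 := (st n).2.
  have I0 : (\int[mu]_x (t n x ^+ 2)%:E = 0)%E.
    rewrite -integrableR_fin //; congr EFin; rewrite -E; apply: orth => //.
    by rewrite E.
  have : (\int[mu]_x `|(t n x ^+ 2)%:E| = 0)%E.
    by under eq_integral do rewrite gee0_abs ?lee_fin ?sqr_ge0 //.
  move=> abs0.
  have [+ _] := ae_eq_integral_abs mu measurableT (measurable_int mu i2).
  move=> /(_ abs0).
  apply: filterS => x /(_ I) [].
  by move/eqP; rewrite sqrf_eq0 => /eqP.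
have := ae_foralln tn; apply: filterS => x tx.
by have [n <-] := tev x.
Qed.

(** The bound is asked only of truncations of z and passes to z by monotone convergence. It serves
    for conditional expectations not yet known to lie in L^2. *)
Lemma sq_integrable_duality z (C : R) : Am z ->
  (forall k, Am k -> sq_integrable mu k ->
     (forall x, k x = z x \/ k x = 0) -> \int[mu]_x (k x ^+ 2) <= C) ->
  sq_integrable mu z.
Proof.
move=> mz bnd; have [t [mt st tz tev nd]] := truncation_exists mz.
have mzX := Am_measurable mz.
split=> //; apply: integrableR_ge0.
- exact: measurable_funX.
- by move=> x; exact: sqr_ge0.
have cv x : ((t n x ^+ 2)%:E)%E @[n --> \oo] --> (z x ^+ 2)%:E.
  have [N tN] := tev x; apply: cvg_near_cst; exists N => // n /= Nn.
  have [-> //|t0] := tz n x.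
  have := nd _ _ x Nn; rewrite t0 tN expr0n /= => H.
  by congr EFin; apply/eqP; rewrite eq_le H sqr_ge0.
have -> : (\int[mu]_x (z x ^+ 2)%:E = limn (fun n => \int[mu]_x (t n x ^+ 2)%:E))%E.
  rewrite -monotone_convergence //.
  - by apply: eq_integral => x _; apply/esym/cvg_lim.
  - by move=> n; apply/measurable_EFinP; exact: integrableR_measurable (st n).2.
  - by move=> n x _; rewrite lee_fin sqr_ge0.
  - by move=> x _ m n mn; rewrite lee_fin nd.
apply: (@le_lt_trans _ _ C%:E); last exact: ltry.
apply: lime_le.
  apply: ereal_nondecreasing_is_cvgn => m n mn; apply: ge0_le_integral => //.
  - by move=> x _; rewrite lee_fin sqr_ge0.
  - exact: measurable_int (st m).2.
  - exact: measurable_int (st n).2.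
  - by move=> x _; rewrite lee_fin nd.
apply: nearW => n; rewrite -integrableR_fin ?lee_fin; last exact: (st n).2.
by apply: bnd => // x; exact: tz.
Qed.

(** Square-integrable test functions already separate A-measurable functions, by
    [ae_eq0_duality]. *)
Lemma has_condexp_unique h g g' : has_condexp mu A h g -> Am g' ->
  (forall k, Am k -> sq_integrable mu k ->
    [/\ integrableR mu (fun x => k x * h x), integrableR mu (fun x => k x * g' x) &
     \int[mu]_x (k x * h x) = \int[mu]_x (k x * g' x)]) ->
  {ae mu, forall x, g x = g' x}.
Proof.
move=> [mh mg E] mg' H.
have : {ae mu, forall x, g x - g' x = 0}.
  apply: (@ae_eq0_duality (fun x => g x - g' x)); first exact: sub_measurableB.
  move=> k mk sk _; have [ih ig' e] := H _ mk sk; have [ig e2] := E _ mk ih.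
  have -> : (fun x => k x * (g x - g' x)) = (fun x => k x * g x - k x * g' x).
    by apply/funext => x; rewrite mulrBr.
  by rewrite RintegralB // -e2 e subrr.
by apply: filterS => x /eqP; rewrite subr_eq0 => /eqP.
Qed.

(** For nonnegative f integrability passes both ways, by pulling |k| out of the nonnegative
    integral; [has_condexp] passes it only from f to g. *)
Lemma condexp_nonneg_integrableR (f g k : X -> R) :
  measurable_fun setT f -> (forall x, 0 <= f x) ->
  condexp_nonneg mu A (fun x => (f x)%:E) (fun x => (g x)%:E) -> Am k ->
  (integrableR mu (fun x => k x * f x) <-> integrableR mu (fun x => k x * g x)) /\
  (integrableR mu (fun x => k x * g x) ->
    \int[mu]_x (k x * f x) = \int[mu]_x (k x * g x)).
Proof.
move=> mf f0 fg mk.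
have [/(A_measurableP sA) mge g0 _] := fg.
have mg : Am g by apply/measurable_EFinP.
have [_ _ E] := has_condexp_nonneg sA subA mf f0 fg.
have iff : integrableR mu (fun x => k x * f x) <-> integrableR mu (fun x => k x * g x).
  split; first by move=> /(E _ mk) [].
  move=> kg; apply/integrableP; split.
    by apply/measurable_EFinP; apply: measurable_funM => //; exact: Am_measurable.
  have [_] := integrableP _ _ _ kg; congr (_ < _)%E.
  have P := @condexp_nonneg_pullout _ _ _ mu A sA subA (fun x => (f x)%:E)
    (fun x => (g x)%:E) (fun x => `|k x|%:E) .
  transitivity (\int[mu]_x (`|k x|%:E * (g x)%:E))%E.
    apply: eq_integral => x _; rewrite EFinM abseM; congr (_ * _)%E.
    by rewrite gee0_abs.
  rewrite -P //.
  - by apply: eq_integral => x _; rewrite EFinM abseM; congr (_ * _)%E; rewrite gee0_abs // lee_fin.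
  - exact/measurable_EFinP.
  - apply/measurable_EFinP; exact: (@measurableT_comp _ _ _ XA).
by split=> // /iff /(E _ mk) [].
Qed.

End Truncation.

(** * The complex space L^2 through real components *)

Section ComplexL2.
Context {R : realType} {d : measure_display} {X : measurableType d}.
Variables (mu : {measure set X -> \bar R}).
Implicit Types f g : X -> R[i].
Local Notation Re := complex.Re.
Local Notation Im := complex.Im.

Lemma complex_eqP (z z' : R[i]) : Re z = Re z' -> Im z = Im z' -> z = z'.
Proof. by case: z z' => [a b] [a' b'] /= -> ->. Qed.

Lemma L2P f : L2 mu f <->
  sq_integrable mu (fun x => Re (f x)) /\ sq_integrable mu (fun x => Im (f x)).
Proof.
split.
  move=> [[m1 m2] lt].
  have i : integrableR mu (fun x => cnormsq (f x)).
    apply: integrableR_ge0 => //.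
      by apply: measurable_funD; exact: measurable_funX.
    by move=> x; rewrite addr_ge0 ?sqr_ge0.
  split; split => //; apply: integrableR_le i; try exact: measurable_funX.
    by move=> x; rewrite ger0_norm ?sqr_ge0 // lerDl sqr_ge0.
  by move=> x; rewrite ger0_norm ?sqr_ge0 // lerDr sqr_ge0.
move=> [[m1 i1] [m2 i2]]; split => //.
exact: integrable_lty (integrableR_D i1 i2).
Qed.

Lemma ReipE f g : Re (ip mu f g) =
  \int[mu]_x (Re (f x) * Re (g x) + Im (f x) * Im (g x)).
Proof.
by rewrite /ip /=; apply: eq_Rintegral => x _ /=; rewrite mulrN opprK.
Qed.

Lemma ImipE f g : Im (ip mu f g) =
  \int[mu]_x (Im (f x) * Re (g x) - Re (f x) * Im (g x)).
Proof.
by rewrite /ip /=; apply: eq_Rintegral => x _ /=; rewrite mulrN addrC.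
Qed.

Lemma ip_integrable f g : L2 mu f -> L2 mu g ->
  integrableR mu (fun x => Re (f x) * Re (g x) + Im (f x) * Im (g x)) /\
  integrableR mu (fun x => Im (f x) * Re (g x) - Re (f x) * Im (g x)).
Proof.
move=> /L2P [f1 f2] /L2P [g1 g2]; split.
  by apply: integrableR_D; exact: sq_integrable_mul.
by apply: integrableR_B; exact: sq_integrable_mul.
Qed.

Lemma norm2sqE f : L2 mu f -> norm2sq mu f = (Re (ip mu f f))%:E.
Proof.
move=> f2; rewrite ReipE integrableR_fin; last exact: (ip_integrable f2 f2).1.
by apply: eq_integral => x _.
Qed.

Lemma Reip_ge0 f : 0 <= Re (ip mu f f).
Proof.
rewrite ReipE; apply: Rintegral_ge0 => x _.
by rewrite addr_ge0 // -expr2 sqr_ge0.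
Qed.

Lemma ipC f g : L2 mu f -> L2 mu g -> ip mu f g = cconj (ip mu g f).
Proof.
move=> f2 g2; apply: complex_eqP.
  by rewrite [RHS]ReipE ReipE; apply: eq_Rintegral => x _; ring.
have [_ i] := ip_integrable g2 f2.
rewrite [RHS]/= ImipE [X in - X]ImipE -mulN1r -RintegralZl //.
by apply: eq_Rintegral => x _; ring.
Qed.

Lemma ae_eq_ip f f' g g' : L2 mu f -> L2 mu f' -> L2 mu g -> L2 mu g' ->
  {ae mu, forall x, f x = f' x} -> {ae mu, forall x, g x = g' x} ->
  ip mu f g = ip mu f' g'.
Proof.
move=> f2 f2' g2 g2' ff gg.
have [i1 i2] := ip_integrable f2 g2; have [j1 j2] := ip_integrable f2' g2'.
apply: complex_eqP; rewrite !(ReipE, ImipE); apply: ae_eq_Rintegral.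
- exact: integrableR_measurable i1.
- exact: integrableR_measurable j1.
- by apply: filterS2 ff gg => x -> ->.
- exact: integrableR_measurable i2.
- exact: integrableR_measurable j2.
- by apply: filterS2 ff gg => x -> ->.
Qed.

Lemma L2_cadd (f g : X -> R[i]) (a b : R[i]) : L2 mu f -> L2 mu g ->
  L2 mu (fun x => Defs.cadd (cmul a (f x)) (cmul b (g x))).
Proof.
move=> /L2P [f1 f2] /L2P [g1 g2]; apply/L2P; split => /=.
- apply: sq_integrableD.
    by apply: sq_integrableD; [|apply: sq_integrableN]; exact: sq_integrableZ.
  by apply: sq_integrableD; [|apply: sq_integrableN]; exact: sq_integrableZ.
- by apply: sq_integrableD; apply: sq_integrableD; exact: sq_integrableZ.
Qed.

(** The product (v1 + i v2)(k1 + i k2). Both T f and |T^2| f have this form, with v fixed and k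
    A-measurable; real components are kept apart because integrals are computed componentwise. *)
Definition cmulf (v1 v2 k1 k2 : X -> R) (x : X) : R[i] :=
  cmul (Complex (v1 x) (v2 x)) (Complex (k1 x) (k2 x)).

End ComplexL2.

(** * Multiplication from L^2(A) into L^2(Sigma) *)

Section Mulc.
Context {R : realType} {d : measure_display} {X : measurableType d}.
Variables (mu : {measure set X -> \bar R}) (A : set (set X)).
Hypotheses (sf : sub_sigma_finite mu A).
Local Notation Am := (sub_measurable A).
Local Notation Re := complex.Re.
Local Notation Im := complex.Im.
Let sA : sigma_algebra setT A. Proof. by case: sf. Qed.
Let subA : A `<=` measurable. Proof. by case: sf. Qed.
Let Am_measurable (k : X -> R) : Am k -> measurable_fun setT k.
Proof. exact: sub_measurableW. Qed.

Variables (v1 v2 nu : X -> R) (K : R).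
Hypotheses (mv1 : measurable_fun setT v1) (mv2 : measurable_fun setT v2)
  (cv : condexp_nonneg mu A (fun x => (v1 x ^+ 2 + v2 x ^+ 2)%:E)
          (fun x => (nu x)%:E))
  (nu0 : forall x, 0 <= nu x) (nuK : forall x, nu x <= K).

Let mnu : Am nu.
Proof. by have [/(A_measurableP sA) m _ _] := cv; apply/measurable_EFinP. Qed.

Let mnorm : measurable_fun setT (fun x => v1 x ^+ 2 + v2 x ^+ 2).
Proof. by apply: measurable_funD; exact: measurable_funX. Qed.

Let norm0 x : 0 <= v1 x ^+ 2 + v2 x ^+ 2.
Proof. by rewrite addr_ge0 ?sqr_ge0. Qed.

(** With nu = E|v|^2 <= K, \int |v|^2 k^2 = \int nu k^2 <= K \int k^2. *)
Lemma sq_integrable_mul_multiplier k : Am k -> sq_integrable mu k ->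
  sq_integrable mu (fun x => v1 x * k x) /\ sq_integrable mu (fun x => v2 x * k x).
Proof.
move=> mk [_ k2].
have mkX := Am_measurable mk.
have knu : integrableR mu (fun x => k x ^+ 2 * nu x).
  apply: integrableR_le (integrableR_Z K k2).
    by apply: measurable_funM; [exact: measurable_funX|exact: Am_measurable].
    move=> x; rewrite ger0_norm; last by apply: mulr_ge0; [exact: sqr_ge0|exact: nu0].
    by rewrite mulrC; apply: ler_wpM2r; [exact: sqr_ge0|exact: nuK].
have [[_ /(_ knu) i] _] := condexp_nonneg_integrableR sf mnorm norm0 cv
   (sub_measurableM mk mk : Am (fun x => k x ^+ 2)).
split; split; try exact: measurable_funM; apply: integrableR_le i.
- by apply: measurable_funX; exact: measurable_funM.
- move=> x; rewrite ger0_norm ?sqr_ge0 // exprMn mulrC ler_wpM2l ?sqr_ge0 //.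
  by rewrite lerDl sqr_ge0.
- by apply: measurable_funX; exact: measurable_funM.
- move=> x; rewrite ger0_norm ?sqr_ge0 // exprMn mulrC ler_wpM2l ?sqr_ge0 //.
  by rewrite lerDr sqr_ge0.
Qed.

Lemma L2_cmulf k1 k2 : Am k1 -> Am k2 -> sq_integrable mu k1 ->
  sq_integrable mu k2 -> L2 mu (cmulf v1 v2 k1 k2).
Proof.
move=> m1 m2 s1 s2.
have [a1 b1] := sq_integrable_mul_multiplier m1 s1.
have [a2 b2] := sq_integrable_mul_multiplier m2 s2.
apply/L2P; split => /=.
  by apply: sq_integrableD => //; exact: sq_integrableN.
exact: sq_integrableD.
Qed.

Let transfer k : Am k -> integrableR mu k ->
  \int[mu]_x (k x * (v1 x ^+ 2 + v2 x ^+ 2)) = \int[mu]_x (nu x * k x).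
Proof.
move=> mk ik; under [RHS]eq_Rintegral do rewrite mulrC.
have [_ E] := condexp_nonneg_integrableR sf mnorm norm0 cv mk.
apply: E; apply: integrableR_le (integrableR_Z K (integrable_norm ik)).
  by apply: measurable_funM; exact: Am_measurable.
by move=> x; rewrite normrM (ger0_norm (nu0 x)) mulrC ler_wpM2r.
Qed.

(** In v k conj(v l) the factor |v|^2 stands against an A-measurable integrand, so E replaces it by
    nu. *)
Lemma ip_cmulf k1 k2 l1 l2 : Am k1 -> Am k2 -> sq_integrable mu k1 ->
  sq_integrable mu k2 -> Am l1 -> Am l2 -> sq_integrable mu l1 ->
  sq_integrable mu l2 ->
  ip mu (cmulf v1 v2 k1 k2) (cmulf v1 v2 l1 l2) =
  Complex (\int[mu]_x (nu x * (k1 x * l1 x + k2 x * l2 x)))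
          (\int[mu]_x (nu x * (k2 x * l1 x - k1 x * l2 x))).
Proof.
move=> m1 m2 s1 s2 n1 n2 t1 t2; apply: complex_eqP; rewrite !(ReipE, ImipE) /=.
  rewrite -(transfer (k := fun x => k1 x * l1 x + k2 x * l2 x)).
  - by apply: eq_Rintegral => x _; ring.
  - by apply: sub_measurableD; exact: sub_measurableM.
  - by apply: integrableR_D; exact: sq_integrable_mul.
rewrite -(transfer (k := fun x => k2 x * l1 x - k1 x * l2 x)).
- by apply: eq_Rintegral => x _; ring.
- by apply: sub_measurableB; exact: sub_measurableM.
- by apply: integrableR_B; exact: sq_integrable_mul.
Qed.

End Mulc.

Lemma ae_eq0_of_Rintegral_le0 {R : realType} {d : measure_display}
    {X : measurableType d} (mu : {measure set X -> \bar R}) (f : X -> R) :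
  integrableR mu f -> (forall x, 0 <= f x) -> \int[mu]_x f x <= 0 ->
  {ae mu, forall x, f x = 0}.
Proof.
move=> intf f0 f_le0.
have abs0 : (\int[mu]_x `|(f x)%:E| = 0)%E.
  under eq_integral do rewrite gee0_abs ?lee_fin ?f0 //.
  rewrite -integrableR_fin //; congr EFin; apply/eqP.
  by rewrite eq_le f_le0; apply: Rintegral_ge0 => x _.
have [+ _] := ae_eq_integral_abs mu measurableT (measurable_int mu intf).
by move=> /(_ abs0); apply: filterS => x /(_ I) [].
Qed.

(** * The normalized operator: weights, |T^2| and both implications *)

Section NormalizedOperator.
Context {R : realType} {d : measure_display} {X : measurableType d}.
Variables (mu : {measure set X -> \bar R}) (A : set (set X)).
Hypotheses (sf : sub_sigma_finite mu A).
Local Notation Am := (sub_measurable A).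
Local Notation Re := complex.Re.
Local Notation Im := complex.Im.
Let sA : sigma_algebra setT A. Proof. by case: sf. Qed.
Let subA : A `<=` measurable. Proof. by case: sf. Qed.
Let Am_measurable (k : X -> R) : Am k -> measurable_fun setT k.
Proof. exact: sub_measurableW. Qed.

Variables (u1 u2 w1 w2 chi om q1 q2 : X -> R) (K : R).
Variables (e1 e2 : (X -> R[i]) -> X -> R) (T : (X -> R[i]) -> (X -> R[i])).
Hypotheses (mu1 : measurable_fun setT u1) (mu2 : measurable_fun setT u2).
Hypotheses (mw1 : measurable_fun setT w1) (mw2 : measurable_fun setT w2).
Hypotheses (cu : condexp_nonneg mu A (fun x => (u1 x ^+ 2 + u2 x ^+ 2)%:E)
                   (fun x => (chi x)%:E))
  (cw : condexp_nonneg mu A (fun x => (w1 x ^+ 2 + w2 x ^+ 2)%:E)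
                   (fun x => (om x)%:E)).
Hypotheses (chi0 : forall x, 0 <= chi x) (chi1 : forall x, chi x <= 1)
  (om0 : forall x, 0 <= om x) (omK : forall x, om x <= K)
  (chi_om : forall x, chi x * om x = om x).
Hypotheses
  (hq1 : has_condexp mu A (fun x => u1 x * w1 x - u2 x * w2 x) q1)
  (hq2 : has_condexp mu A (fun x => u1 x * w2 x + u2 x * w1 x) q2).
Hypotheses
  (he1 : forall f, L2 mu f ->
    has_condexp mu A (fun x => u1 x * Re (f x) - u2 x * Im (f x)) (e1 f))
  (he2 : forall f, L2 mu f ->
    has_condexp mu A (fun x => u1 x * Im (f x) + u2 x * Re (f x)) (e2 f)).
Hypotheses
  (hT : forall f, L2 mu f -> {ae mu, forall x, T f x = cmulf w1 w2 (e1 f) (e2 f) x})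
  (bT : bounded_L2 mu T).

Let cu' : condexp_nonneg mu A (fun x => (u1 x ^+ 2 + (- u2 x) ^+ 2)%:E)
                   (fun x => (chi x)%:E).
Proof. by under eq_fun do rewrite sqrrN. Qed.

Let mu2' : measurable_fun setT (fun x => - u2 x).
Proof. exact: measurable_funN. Qed.

Let mchi : Am chi.
Proof. by have [/(A_measurableP sA) m _ _] := cu; apply/measurable_EFinP. Qed.

Let mom : Am om.
Proof. by have [/(A_measurableP sA) m _ _] := cw; apply/measurable_EFinP. Qed.

Let me1 f : L2 mu f -> Am (e1 f). Proof. by move=> /he1 []. Qed.
Let me2 f : L2 mu f -> Am (e2 f). Proof. by move=> /he2 []. Qed.
Let mq1 : Am q1. Proof. by case: hq1. Qed.
Let mq2 : Am q2. Proof. by case: hq2. Qed.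

Let L2_T f : L2 mu f -> L2 mu (T f).
Proof. by have [c bc] := bT; move=> /bc []. Qed.

Let sq_u k : Am k -> sq_integrable mu k ->
  sq_integrable mu (fun x => u1 x * k x) /\ sq_integrable mu (fun x => u2 x * k x).
Proof.
by move=> mk; exact: (sq_integrable_mul_multiplier sf mu1 mu2 cu chi0 chi1 mk).
Qed.

Let sq_w k : Am k -> sq_integrable mu k ->
  sq_integrable mu (fun x => w1 x * k x) /\ sq_integrable mu (fun x => w2 x * k x).
Proof.
by move=> mk; exact: (sq_integrable_mul_multiplier sf mw1 mw2 cw om0 omK mk).
Qed.

(** An a priori estimate: for a truncation k of e, \int k^2 = \int k e = \int k (u1 f1 + u2 f2), and
    twice this is at most \int |u|^2 k^2 + C = \int chi k^2 + C <= \int k^2 + C. Hence \int k^2 <=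
    C: since E|u|^2 <= 1, f |-> E(uf) is a contraction. *)
Let sq_condexp f1 f2 e : has_condexp mu A (fun x => u1 x * f1 x + u2 x * f2 x) e ->
  sq_integrable mu f1 -> sq_integrable mu f2 -> sq_integrable mu e.
Proof.
move=> [mh me E] s1 s2.
pose C := \int[mu]_x (f1 x ^+ 2 + f2 x ^+ 2).
apply: (@sq_integrable_duality _ _ _ _ _ sf _ C) => // k mk sk kz.
have [k1 k2] := sq_u mk sk.
have i1 := sq_integrable_mul k1 s1; have i2 := sq_integrable_mul k2 s2.
have kE : (fun x => k x * (u1 x * f1 x + u2 x * f2 x)) =
   (fun x => u1 x * k x * f1 x + u2 x * k x * f2 x).
  by apply/funext => x; ring.
have ih : integrableR mu (fun x => k x * (u1 x * f1 x + u2 x * f2 x)).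
  by rewrite kE; exact: integrableR_D.
have [ie Ie] := E _ mk ih.
have sE : (fun x => k x * e x) = (fun x => k x ^+ 2).
  by apply/funext => x; have [->|->] := kz x; rewrite expr2 ?mul0r.
rewrite sE in Ie.
have ichi : integrableR mu (fun x => k x ^+ 2 * chi x).
  apply: integrableR_le sk.2.
    by apply: measurable_funM; [apply: measurable_funX|]; exact: Am_measurable.
  move=> x; rewrite ger0_norm; last by apply: mulr_ge0; [exact: sqr_ge0|exact: chi0].
  by apply: ler_piMr; [exact: sqr_ge0|exact: chi1].
have mnorm : measurable_fun setT (fun x => u1 x ^+ 2 + u2 x ^+ 2).
  by apply: measurable_funD; exact: measurable_funX.
have [iff /(_ ichi) Iu] := condexp_nonneg_integrableR sf mnorm
  (fun x => addr_ge0 (sqr_ge0 (u1 x)) (sqr_ge0 (u2 x))) cu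
   (sub_measurableM mk mk : Am (fun x => k x ^+ 2)).
have iu := iff.2 ichi.
have iC : integrableR mu (fun x => f1 x ^+ 2 + f2 x ^+ 2).
  by apply: integrableR_D; [exact: s1.2|exact: s2.2].
have h1 : 2 * \int[mu]_x (k x ^+ 2) <= \int[mu]_x (k x ^+ 2) + C.
  rewrite -{1}Ie kE -RintegralZl //; last exact: integrableR_D.
  apply: (@le_trans _ _ (\int[mu]_x (k x ^+ 2 * (u1 x ^+ 2 + u2 x ^+ 2) +
    (f1 x ^+ 2 + f2 x ^+ 2)))).
    apply: le_Rintegral => //.
    - by apply: integrableR_Z; exact: integrableR_D.
    - exact: integrableR_D.
    move=> x _.
    have := sqr_ge0 (u1 x * k x - f1 x); have := sqr_ge0 (u2 x * k x - f2 x); lra.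
  rewrite RintegralD // Iu lerD2r; apply: le_Rintegral => //; first exact: sk.2.
  by move=> x _; apply: ler_piMr; [exact: sqr_ge0|exact: chi1].
lra.
Qed.

Lemma sq_e1 f : L2 mu f -> sq_integrable mu (e1 f).
Proof.
move=> f2; have [r i] := (L2P mu f).1 f2.
apply: (sq_condexp (f1 := fun x => Re (f x)) (f2 := fun x => - Im (f x))) => //.
  rewrite (_ : (fun x => _) = (fun x => u1 x * Re (f x) - u2 x * Im (f x))).
    exact: he1.
  by apply/funext => x; rewrite mulrN.
exact: sq_integrableN.
Qed.

Lemma sq_e2 f : L2 mu f -> sq_integrable mu (e2 f).
Proof.
move=> f2; have [r i] := (L2P mu f).1 f2.
exact: (sq_condexp (he2 f2)).
Qed.

Let pair_h k f : Am k -> sq_integrable mu k -> L2 mu f ->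
  [/\ integrableR mu (fun x => k x * (u1 x * Re (f x) - u2 x * Im (f x))),
      integrableR mu (fun x => k x * (u1 x * Im (f x) + u2 x * Re (f x))),
      \int[mu]_x (k x * (u1 x * Re (f x) - u2 x * Im (f x))) =
        \int[mu]_x (k x * e1 f x) &
      \int[mu]_x (k x * (u1 x * Im (f x) + u2 x * Re (f x))) =
        \int[mu]_x (k x * e2 f x)].
Proof.
move=> mk sk f2; have [r i] := (L2P mu f).1 f2.
have [k1 k2] := sq_u mk sk.
have i1 : integrableR mu (fun x => k x * (u1 x * Re (f x) - u2 x * Im (f x))).
  rewrite (_ : (fun x => _) = (fun x => u1 x * k x * Re (f x) - u2 x * k x * Im (f x))).
    by apply: integrableR_B; exact: sq_integrable_mul.
  by apply/funext => x; ring.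
have i2 : integrableR mu (fun x => k x * (u1 x * Im (f x) + u2 x * Re (f x))).
  rewrite (_ : (fun x => _) = (fun x => u1 x * k x * Im (f x) + u2 x * k x * Re (f x))).
    by apply: integrableR_D; exact: sq_integrable_mul.
  by apply/funext => x; ring.
have [_ _ /(_ _ mk i1) [_ E1]] := he1 f2.
have [_ _ /(_ _ mk i2) [_ E2]] := he2 f2.
by split.
Qed.

Local Notation J := (cmulf u1 (fun x => - u2 x)).

Lemma L2_J k1 k2 : Am k1 -> Am k2 -> sq_integrable mu k1 -> sq_integrable mu k2 ->
  L2 mu (J k1 k2).
Proof.
by move=> m1; exact: (L2_cmulf sf mu1 mu2' cu' chi0 chi1 m1).
Qed.

(** [J] sends k to conj(u) k, and <conj(u) k, g> = <k, E(ug)>: it is the adjoint of g |-> e_g from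
    L^2(Sigma) to L^2(A). *)
Lemma ip_J k1 k2 g : Am k1 -> Am k2 -> sq_integrable mu k1 ->
  sq_integrable mu k2 -> L2 mu g ->
  ip mu (J k1 k2) g =
  Complex (\int[mu]_x (k1 x * e1 g x + k2 x * e2 g x))
          (\int[mu]_x (k2 x * e1 g x - k1 x * e2 g x)).
Proof.
move=> m1 m2 s1 s2 g2.
have [a1 a2 b1 b2] := pair_h m1 s1 g2; have [c1 c2 d1 d2] := pair_h m2 s2 g2.
have se1 := sq_e1 g2; have se2 := sq_e2 g2.
have j11 := sq_integrable_mul s1 se1; have j12 := sq_integrable_mul s1 se2.
have j21 := sq_integrable_mul s2 se1; have j22 := sq_integrable_mul s2 se2.
apply: complex_eqP; rewrite !(ReipE, ImipE) /=.
  rewrite [RHS]RintegralD //.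
  by rewrite -b1 -d2 -RintegralD //; apply: eq_Rintegral => x _; ring.
rewrite [RHS]RintegralB //.
by rewrite -d1 -b2 -RintegralB //; apply: eq_Rintegral => x _; ring.
Qed.

Lemma ip_T f g : L2 mu f -> L2 mu g ->
  ip mu (T f) (T g) =
  Complex (\int[mu]_x (om x * (e1 f x * e1 g x + e2 f x * e2 g x)))
          (\int[mu]_x (om x * (e2 f x * e1 g x - e1 f x * e2 g x))).
Proof.
move=> f2 g2.
have L h : L2 mu h -> L2 mu (cmulf w1 w2 (e1 h) (e2 h)).
  move=> h2; apply: (L2_cmulf sf mw1 mw2 cw om0 omK);
    by [exact: me1|exact: me2|exact: sq_e1|exact: sq_e2].
rewrite (ae_eq_ip (L2_T f2) (L _ f2) (L2_T g2) (L _ g2) (hT f2) (hT g2)).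
by apply: (ip_cmulf sf mw1 mw2 cw om0 omK);
  by [exact: me1|exact: me2|exact: sq_e1|exact: sq_e2].
Qed.

Let norm2sq_T f : L2 mu f -> fine (norm2sq mu (T f)) =
  \int[mu]_x (om x * (e1 f x * e1 f x + e2 f x * e2 f x)).
Proof. by move=> f2; rewrite norm2sqE; [rewrite ip_T|exact: L2_T]. Qed.

(** The test function for q is a product k e of two square-integrable functions. Its integrability
    against uw, which [has_condexp] asks for, comes from grouping the factors as u k and w e. *)
Let pair_q k e : Am k -> sq_integrable mu k -> Am e -> sq_integrable mu e ->
  [/\ integrableR mu (fun x => k x * e x * (u1 x * w1 x - u2 x * w2 x)),
      integrableR mu (fun x => k x * e x * (u1 x * w2 x + u2 x * w1 x)),
      integrableR mu (fun x => k x * e x * q1 x) /\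
      \int[mu]_x (k x * e x * (u1 x * w1 x - u2 x * w2 x)) =
        \int[mu]_x (k x * e x * q1 x) &
      integrableR mu (fun x => k x * e x * q2 x) /\
      \int[mu]_x (k x * e x * (u1 x * w2 x + u2 x * w1 x)) =
        \int[mu]_x (k x * e x * q2 x)].
Proof.
move=> mk sk me se.
have [k1 k2] := sq_u mk sk; have [l1 l2] := sq_w me se.
have i1 : integrableR mu (fun x => k x * e x * (u1 x * w1 x - u2 x * w2 x)).
  rewrite (_ : (fun x => _) = (fun x => u1 x * k x * (w1 x * e x) - u2 x * k x * (w2 x * e x))).
    by apply: integrableR_B; exact: sq_integrable_mul.
  by apply/funext => x; ring.
have i2 : integrableR mu (fun x => k x * e x * (u1 x * w2 x + u2 x * w1 x)).
  rewrite (_ : (fun x => _) = (fun x => u1 x * k x * (w2 x * e x) + u2 x * k x * (w1 x * e x))).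
    by apply: integrableR_D; exact: sq_integrable_mul.
  by apply/funext => x; ring.
have mke := sub_measurableM mk me.
have [_ _ /(_ _ mke i1) E1] := hq1.
have [_ _ /(_ _ mke i2) E2] := hq2.
by split.
Qed.

(** Pull-out: E(u w e_f) = E(uw) e_f. The right side is identified by uniqueness, testing against k
    in L^2(A). *)
Lemma e_T f : L2 mu f ->
  {ae mu, forall x, e1 (T f) x = q1 x * e1 f x - q2 x * e2 f x /\
                    e2 (T f) x = q1 x * e2 f x + q2 x * e1 f x}.
Proof.
move=> f2; have g2 := L2_T f2.
have se1 := sq_e1 f2; have se2 := sq_e2 f2.
have m1 := me1 f2; have m2 := me2 f2.
have E1 : {ae mu, forall x, e1 (T f) x = q1 x * e1 f x - q2 x * e2 f x}.
  apply: (has_condexp_unique sf (he1 g2)).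
    by apply: sub_measurableB; exact: sub_measurableM.
  move=> k mk sk; have [ih _ _ _] := pair_h mk sk g2.
  have [a _ [a' aE] _] := pair_q mk sk m1 se1.
  have [_ b _ [b' bE]] := pair_q mk sk m2 se2.
  have qE : (fun x => k x * (q1 x * e1 f x - q2 x * e2 f x)) =
      (fun x => k x * e1 f x * q1 x - k x * e2 f x * q2 x).
    by apply/funext => x; ring.
  split => //; first by rewrite qE; exact: integrableR_B.
  rewrite qE [RHS]RintegralB // -aE -bE -RintegralB //.
  apply: ae_eq_Rintegral.
  - exact: integrableR_measurable ih.
  - exact: integrableR_measurable (integrableR_B a b).
  - by apply: filterS (hT f2) => x -> /=; ring.
have E2 : {ae mu, forall x, e2 (T f) x = q1 x * e2 f x + q2 x * e1 f x}.
  apply: (has_condexp_unique sf (he2 g2)).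
    by apply: sub_measurableD; exact: sub_measurableM.
  move=> k mk sk; have [_ ih _ _] := pair_h mk sk g2.
  have [_ a _ [a' aE]] := pair_q mk sk m1 se1.
  have [b _ [b' bE] _] := pair_q mk sk m2 se2.
  have qE : (fun x => k x * (q1 x * e2 f x + q2 x * e1 f x)) =
      (fun x => k x * e2 f x * q1 x + k x * e1 f x * q2 x).
    by apply/funext => x; ring.
  split => //; first by rewrite qE; exact: integrableR_D.
  rewrite qE [RHS]RintegralD // -aE -bE -RintegralD //.
  apply: ae_eq_Rintegral.
  - exact: integrableR_measurable ih.
  - exact: integrableR_measurable (integrableR_D b a).
  - by apply: filterS (hT f2) => x -> /=; ring.
by apply: filterS2 E1 E2.
Qed.

Let qq x := q1 x ^+ 2 + q2 x ^+ 2.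
Let a x := Num.sqrt (om x * qq x).

Let mqq : Am qq.
Proof.
by apply: sub_measurableD; exact: sub_measurableM.
Qed.

Let ma : Am a.
Proof.
have mom_qq : Am (fun x => om x * qq x) by exact: sub_measurableM.
exact: (measurableT_comp (continuous_measurable_fun (@sqrt_continuous R)) mom_qq).
Qed.

Let qq0 x : 0 <= qq x. Proof. by rewrite addr_ge0 ?sqr_ge0. Qed.

Let a2 x : a x ^+ 2 = om x * qq x.
Proof. by rewrite sqr_sqrtr // mulr_ge0. Qed.

Let chi_a2 x : chi x * a x ^+ 2 = om x * qq x.
Proof. by rewrite a2 mulrA chi_om. Qed.

Let a0 x : 0 <= a x. Proof. exact: sqrtr_ge0. Qed.

Lemma ip_TT f g : L2 mu f -> L2 mu g ->
  ip mu (T (T f)) (T (T g)) =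
  Complex (\int[mu]_x (om x * (qq x * (e1 f x * e1 g x + e2 f x * e2 g x))))
          (\int[mu]_x (om x * (qq x * (e2 f x * e1 g x - e1 f x * e2 g x)))).
Proof.
move=> f2 g2; rewrite (ip_T (L2_T f2) (L2_T g2)).
have [A1 A2 B1 B2] : [/\ Am (e1 (T f)), Am (e2 (T f)), Am (e1 (T g)) & Am (e2 (T g))].
  by split; [apply: me1|apply: me2|apply: me1|apply: me2]; exact: L2_T.
have [C1 C2 D1 D2] : [/\ Am (e1 f), Am (e2 f), Am (e1 g) & Am (e2 g)].
  by split; [apply: me1|apply: me2|apply: me1|apply: me2].
congr Complex; apply: ae_eq_Rintegral.
- apply: Am_measurable; apply: sub_measurableM => //.
  by apply: sub_measurableD; exact: sub_measurableM.
- apply: Am_measurable; apply: sub_measurableM => //; apply: sub_measurableM => //.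
  by apply: sub_measurableD; exact: sub_measurableM.
- apply: filterS2 (e_T f2) (e_T g2) => x [-> ->] [-> ->]; rewrite /qq; ring.
- apply: Am_measurable; apply: sub_measurableM => //.
  by apply: sub_measurableB; exact: sub_measurableM.
- apply: Am_measurable; apply: sub_measurableM => //; apply: sub_measurableM => //.
  by apply: sub_measurableB; exact: sub_measurableM.
- apply: filterS2 (e_T f2) (e_T g2) => x [-> ->] [-> ->]; rewrite /qq; ring.
Qed.

(** No bound on q is at hand; q e_f is square-integrable because it equals e_(Tf) and T f lies in
    L^2. *)
Let int_TT f : L2 mu f ->
  integrableR mu (fun x => om x * (qq x * (e1 f x ^+ 2 + e2 f x ^+ 2))).
Proof.
move=> f2; have g2 := L2_T f2.
have [m1 i1] := sq_e1 g2; have [m2 i2] := sq_e2 g2.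
apply: (ae_eq_integrableR (f := fun x => om x * (e1 (T f) x ^+ 2 + e2 (T f) x ^+ 2))).
- apply: Am_measurable; apply: sub_measurableM => //; apply: sub_measurableM => //.
  by apply: sub_measurableD; apply: sub_measurableM; by [exact: me1|exact: me2].
- apply: filterS (e_T f2) => x [-> ->]; rewrite /qq; ring.
apply: integrableR_le (integrableR_Z K (integrableR_D i1 i2)).
  apply: measurable_funM; first exact: Am_measurable.
  by apply: measurable_funD; exact: measurable_funX.
move=> x; have e0 : 0 <= e1 (T f) x ^+ 2 + e2 (T f) x ^+ 2.
  by rewrite addr_ge0 ?sqr_ge0.
rewrite ger0_norm; last by apply: mulr_ge0.
exact: ler_wpM2r.
Qed.

Let sq_a f : L2 mu f -> sq_integrable mu (fun x => a x * e1 f x) /\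
  sq_integrable mu (fun x => a x * e2 f x).
Proof.
move=> f2; have i := int_TT f2.
have aux (e : X -> R) : Am e -> (forall x, e x ^+ 2 <= e1 f x ^+ 2 + e2 f x ^+ 2) ->
    sq_integrable mu (fun x => a x * e x).
  move=> me le; have mae := Am_measurable (sub_measurableM ma me).
  split => //; apply: integrableR_le i; first exact: measurable_funX.
  move=> x; rewrite ger0_norm ?sqr_ge0 // exprMn a2 mulrA.
  by apply: ler_wpM2l => //; exact: mulr_ge0.
split; apply: aux; [exact: me1| |exact: me2|] => x; by rewrite ?lerDl ?lerDr sqr_ge0.
Qed.

(** The form <T^2 f, T^2 g> has weight om |q|^2. Applying [Rop] twice passes through E(|u|^2 a e_f)
    = chi a e_f and gives weight chi a^2, which is why a is the square root of om |q|^2. *)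
Let Rop f := J (fun x => a x * e1 f x) (fun x => a x * e2 f x).

Let mae1 f : L2 mu f -> Am (fun x => a x * e1 f x).
Proof. by move=> f2; apply: sub_measurableM => //; exact: me1. Qed.

Let mae2 f : L2 mu f -> Am (fun x => a x * e2 f x).
Proof. by move=> f2; apply: sub_measurableM => //; exact: me2. Qed.

Let L2_Rop f : L2 mu f -> L2 mu (Rop f).
Proof.
move=> f2; have [s1 s2] := sq_a f2.
by apply: L2_J => //; [exact: mae1|exact: mae2].
Qed.

Let ip_Rop f g : L2 mu f -> L2 mu g -> ip mu (Rop f) g =
  Complex (\int[mu]_x (a x * (e1 f x * e1 g x + e2 f x * e2 g x)))
          (\int[mu]_x (a x * (e2 f x * e1 g x - e1 f x * e2 g x))).
Proof.
move=> f2 g2; have [s1 s2] := sq_a f2.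
rewrite (ip_J (mae1 f2) (mae2 f2) s1 s2 g2).
by congr Complex; apply: eq_Rintegral => x _; ring.
Qed.

Let ip_Rop2 f g : L2 mu f -> L2 mu g ->
  ip mu (Rop f) (Rop g) = ip mu (T (T f)) (T (T g)).
Proof.
move=> f2 g2; have [s1 s2] := sq_a f2; have [t1 t2] := sq_a g2.
rewrite ip_TT // (ip_cmulf sf mu1 mu2' cu' chi0 chi1 (mae1 f2) (mae2 f2) s1 s2
  (mae1 g2) (mae2 g2) t1 t2).
congr Complex; apply: eq_Rintegral => x _.
  transitivity (chi x * a x ^+ 2 * (e1 f x * e1 g x + e2 f x * e2 g x)); first ring.
  by rewrite chi_a2 mulrA.
transitivity (chi x * a x ^+ 2 * (e2 f x * e1 g x - e1 f x * e2 g x)); first ring.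
by rewrite chi_a2 mulrA.
Qed.

(** [e1] and [e2] are arbitrary versions, so linearity holds almost everywhere only. A sum may be
    integrable against k when its terms are not; here k, f and g are square-integrable, so every
    term is. *)
Let e_cadd f g (b c : R[i]) : L2 mu f -> L2 mu g ->
  let h := fun y => Defs.cadd (cmul b (f y)) (cmul c (g y)) in
  {ae mu, forall x,
    e1 h x = Re b * e1 f x - Im b * e2 f x + (Re c * e1 g x - Im c * e2 g x) /\
    e2 h x = Re b * e2 f x + Im b * e1 f x + (Re c * e2 g x + Im c * e1 g x)}.
Proof.
move=> f2 g2 h; have h2 : L2 mu h by exact: L2_cadd.
have mZ (r : R) (k : X -> R) : Am k -> Am (fun x => r * k x).
  by move=> mk; apply: sub_measurableM => //; exact: measurable_cst.
have [p1 p2 r1 r2] := And4 (me1 f2) (me2 f2) (me1 g2) (me2 g2).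
have lin4 (r1' r2' r3' r4' : R) (p1' p2' p3' p4' : X -> R) :
    integrableR mu p1' -> integrableR mu p2' -> integrableR mu p3' ->
    integrableR mu p4' ->
    integrableR mu (fun x => r1' * p1' x + r2' * p2' x + (r3' * p3' x + r4' * p4' x)) /\
    \int[mu]_x (r1' * p1' x + r2' * p2' x + (r3' * p3' x + r4' * p4' x)) =
    r1' * \int[mu]_x p1' x + r2' * \int[mu]_x p2' x +
    (r3' * \int[mu]_x p3' x + r4' * \int[mu]_x p4' x).
  move=> i1 i2 i3 i4.
  have [j1 j2] := conj (integrableR_Z r1' i1) (integrableR_Z r2' i2).
  have [j3 j4] := conj (integrableR_Z r3' i3) (integrableR_Z r4' i4).
  have [j12 j34] := conj (integrableR_D j1 j2) (integrableR_D j3 j4).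
  split; first exact: integrableR_D.
  by rewrite !RintegralD // !RintegralZl.
have E1 : {ae mu, forall x, e1 h x =
    Re b * e1 f x - Im b * e2 f x + (Re c * e1 g x - Im c * e2 g x)}.
  apply: (has_condexp_unique sf (he1 h2)).
    by apply: sub_measurableD; apply: sub_measurableB; exact: mZ.
  move=> k mk sk; have [ih _ _ _] := pair_h mk sk h2.
  have [f1 f1' F1 F1'] := pair_h mk sk f2; have [g1 g1' G1 G1'] := pair_h mk sk g2.
  have [_ Eh] := lin4 (Re b) (- Im b) (Re c) (- Im c) _ _ _ _ f1 f1' g1 g1'.
  have [ie Ee] := lin4 (Re b) (- Im b) (Re c) (- Im c) _ _ _ _
    (sq_integrable_mul sk (sq_e1 f2)) (sq_integrable_mul sk (sq_e2 f2))
    (sq_integrable_mul sk (sq_e1 g2)) (sq_integrable_mul sk (sq_e2 g2)).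
  have eE : (fun x => k x * (Re b * e1 f x - Im b * e2 f x +
       (Re c * e1 g x - Im c * e2 g x))) =
      (fun x => (Re b * (k x * e1 f x) + - Im b * (k x * e2 f x)) +
       (Re c * (k x * e1 g x) + - Im c * (k x * e2 g x))).
    by apply/funext => x; ring.
  rewrite eE; split => //; rewrite Ee -F1 -F1' -G1 -G1' -Eh.
  by apply: eq_Rintegral => x _ /=; ring.
have E2 : {ae mu, forall x, e2 h x =
    Re b * e2 f x + Im b * e1 f x + (Re c * e2 g x + Im c * e1 g x)}.
  apply: (has_condexp_unique sf (he2 h2)).
    by apply: sub_measurableD; apply: sub_measurableD; exact: mZ.
  move=> k mk sk; have [_ ih _ _] := pair_h mk sk h2.
  have [f1 f1' F1 F1'] := pair_h mk sk f2; have [g1 g1' G1 G1'] := pair_h mk sk g2.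
  have [_ Eh] := lin4 (Re b) (Im b) (Re c) (Im c) _ _ _ _ f1' f1 g1' g1.
  have [ie Ee] := lin4 (Re b) (Im b) (Re c) (Im c) _ _ _ _
    (sq_integrable_mul sk (sq_e2 f2)) (sq_integrable_mul sk (sq_e1 f2))
    (sq_integrable_mul sk (sq_e2 g2)) (sq_integrable_mul sk (sq_e1 g2)).
  have eE : (fun x => k x * (Re b * e2 f x + Im b * e1 f x +
       (Re c * e2 g x + Im c * e1 g x))) =
      (fun x => (Re b * (k x * e2 f x) + Im b * (k x * e1 f x)) +
       (Re c * (k x * e2 g x) + Im c * (k x * e1 g x))).
    by apply/funext => x; ring.
  rewrite eE; split => //; rewrite Ee -F1 -F1' -G1 -G1' -Eh.
  by apply: eq_Rintegral => x _ /=; ring.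
by apply: filterS2 E1 E2.
Qed.

Lemma is_abs_T2_Rop : is_abs_T2 mu T Rop.
Proof.
split.
(* [Rop f] has the norm of T (T f), so the bound of T is used twice; absolute values are taken
   because c may be negative. *)
- have [c bc] := bT; exists (`|c| * `|c|) => f f2; split; first exact: L2_Rop.
  rewrite norm2sqE; last exact: L2_Rop.
  rewrite ip_Rop2 // -norm2sqE; last exact/L2_T/L2_T.
  have le g : L2 mu g -> (norm2sq mu (T g) <= `|c|%:E * norm2sq mu g)%E.
    move=> g2; have [_ le1] := bc _ g2; apply: le_trans le1 _.
    rewrite lee_wpmul2r ?lee_fin ?ler_norm // norm2sqE // lee_fin.
    exact: Reip_ge0.
  apply: le_trans (le _ (L2_T f2)) _; rewrite EFinM -muleA.
  by apply: lee_wpmul2l; [rewrite lee_fin|exact: le].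
- move=> f g b c f2 g2; apply: filterS (e_cadd b c f2 g2) => x /= [E1 E2].
  by rewrite /Rop /cmulf E1 E2; apply: complex_eqP => /=; ring.
- move=> f g f2 g2; rewrite (ipC f2 (L2_Rop g2)) !ip_Rop //.
  apply: complex_eqP => /=; first by apply: eq_Rintegral => x _; ring.
  have [s1 s2] := sq_a g2.
  have ii : integrableR mu (fun x => a x * (e2 g x * e1 f x - e1 g x * e2 f x)).
    have := integrableR_B (sq_integrable_mul s2 (sq_e1 f2))
      (sq_integrable_mul s1 (sq_e2 f2)).
    by congr (integrableR mu _); apply/funext => x; ring.
  rewrite -mulN1r -RintegralZl //; apply: eq_Rintegral => x _; ring.
- move=> f f2; rewrite ip_Rop //=; apply: Rintegral_ge0 => x _.
  by apply: mulr_ge0 => //; rewrite addr_ge0 // -expr2 sqr_ge0.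
- exact: ip_Rop2.
Qed.

Let sq_om f : L2 mu f -> sq_integrable mu (fun x => om x * e1 f x) /\
  sq_integrable mu (fun x => om x * e2 f x).
Proof.
move=> f2; have aux e : Am e -> sq_integrable mu e ->
    sq_integrable mu (fun x => om x * e x).
  move=> me se; apply: sq_integrable_le (sq_integrableZ K se).
    exact: Am_measurable (sub_measurableM mom me).
  move=> x; rewrite !exprMn; apply: ler_wpM2r; first exact: sqr_ge0.
  by rewrite lerXn2r ?nnegrE // (le_trans (om0 x)).
by split; apply: aux; [exact: me1|exact: sq_e1|exact: me2|exact: sq_e2].
Qed.

Lemma A_class_of_le : {ae mu, forall x, om x <= qq x} -> A_class mu T.
Proof.
move=> om_qq S [[cS bS] _ symS posS absS] f0 f02.
pose P f := J (fun x => om x * e1 f x) (fun x => om x * e2 f x).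
have mo1 f : L2 mu f -> Am (fun x => om x * e1 f x).
  by move=> f2; apply: sub_measurableM => //; exact: me1.
have mo2 f : L2 mu f -> Am (fun x => om x * e2 f x).
  by move=> f2; apply: sub_measurableM => //; exact: me2.
have L2_P f : L2 mu f -> L2 mu (P f).
  by move=> f2; have [? ?] := sq_om f2; apply: L2_J => //; [exact: mo1|exact: mo2].
have L2_S f : L2 mu f -> L2 mu (S f) by move=> /bS [].
have ip_P f g : L2 mu f -> L2 mu g -> Re (ip mu (P f) g) =
    \int[mu]_x (om x * (e1 f x * e1 g x + e2 f x * e2 g x)).
  move=> f2 g2; have [s1 s2] := sq_om f2.
  rewrite (ip_J (mo1 _ f2) (mo2 _ f2) s1 s2 g2) /=.
  by apply: eq_Rintegral => x _; ring.
(* Here P is T^*T: the squared norm of P f has weight chi om^2 = om^2, and that of S f, equal to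
   that of T (T f), has weight om |q|^2. *)
have PS f : L2 mu f -> Re (ip mu (P f) (P f)) <= Re (ip mu (S f) (S f)).
  move=> f2; have [s1 s2] := sq_om f2.
  rewrite absS // ip_TT // (ip_cmulf sf mu1 mu2' cu' chi0 chi1 (mo1 _ f2)
    (mo2 _ f2) s1 s2 (mo1 _ f2) (mo2 _ f2) s1 s2) /=.
  have ip2 : integrableR mu (fun x => om x * e1 f x * (om x * e1 f x) +
      om x * e2 f x * (om x * e2 f x)).
    by apply: integrableR_D; exact: sq_integrable_mul.
  have i2 : integrableR mu (fun x => om x * (om x * (e1 f x * e1 f x + e2 f x * e2 f x))).
    by move: ip2; congr (integrableR mu _); apply/funext => x; ring.
  have := int_TT f2; rewrite (_ : (fun x => _) =
      (fun x => om x * (qq x * (e1 f x * e1 f x + e2 f x * e2 f x)))) => [i3|].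
    rewrite (_ : Rintegral _ _ _ =
        \int[mu]_x (om x * (om x * (e1 f x * e1 f x + e2 f x * e2 f x)))); last first.
      apply: eq_Rintegral => x _.
      transitivity (chi x * om x * (om x * (e1 f x * e1 f x + e2 f x * e2 f x))).
        by ring.
      by rewrite chi_om.
    rewrite -lee_fin !integrableR_fin //; apply: ae_ge0_le_integral => //.
    - move=> x _; rewrite lee_fin; apply: mulr_ge0 => //; apply: mulr_ge0 => //.
      by rewrite addr_ge0 // -expr2 sqr_ge0.
    - exact: measurable_int i2.
    - move=> x _; rewrite lee_fin; apply: mulr_ge0 => //; apply: mulr_ge0 => //.
      by rewrite addr_ge0 // -expr2 sqr_ge0.
    - exact: measurable_int i3.
    - apply: filterS om_qq => x le _; rewrite lee_fin; apply: ler_wpM2l => //.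
      by apply: ler_wpM2r => //; rewrite addr_ge0 // -expr2 sqr_ge0.
  by apply/funext => x; rewrite !expr2.
rewrite norm2sq_T // -ip_P //.
(* Representatives of L^2 with the real part of the inner product, a symmetric form that vanishes on
   null functions. *)
pose V := {f : X -> R[i] | L2 mu f}.
pose n (f g : V) := Re (ip mu (sval f) (sval g)).
pose comb (f : V) (t : R) (g : V) : V := exist _ _
  (L2_cadd (Complex 1 0) (Complex t 0) (svalP f) (svalP g)).
pose PV (f : V) : V := exist _ _ (L2_P _ (svalP f)).
pose SV (f : V) : V := exist _ _ (L2_S _ (svalP f)).
have n_sym f g : n f g = n g f.
  by rewrite /n (ipC (svalP f) (svalP g)).
have SV_bnd f : n (SV f) (SV f) <= `|cS| * n f f.
  have [_] := bS _ (svalP f); rewrite !norm2sqE; [|exact: svalP|exact: L2_S (svalP f)].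
  rewrite -EFinM lee_fin => le; apply: le_trans le _.
  by apply: ler_wpM2r; [exact: Reip_ge0|exact: ler_norm].
have := @loewner_heinz_sqrt R V n comb PV SV `|cS| n_sym _ _ _ _ _ _ _ _ SV_bnd
  (exist _ f0 f02) (fun g => PS _ (svalP g)).
apply => //.
- move=> f t g k; rewrite /n !ReipE /=.
  have [i1 _] := ip_integrable (svalP f) (svalP k).
  have [i2 _] := ip_integrable (svalP g) (svalP k).
  rewrite -RintegralZl // -RintegralD //; last exact: integrableR_Z.
  by apply: eq_Rintegral => x _ /=; ring.
- by move=> f; exact: Reip_ge0.
- move=> f g; rewrite [RHS]n_sym.
  change (Re (ip mu (P (sval f)) (sval g)) = Re (ip mu (P (sval g)) (sval f))).
  rewrite !ip_P; try exact: svalP.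
  by apply: eq_Rintegral => x _; ring.
- move=> f; change (0 <= Re (ip mu (P (sval f)) (sval f))).
  rewrite ip_P; try exact: svalP.
  apply: Rintegral_ge0 => x _; apply: mulr_ge0 => //.
  by rewrite addr_ge0 // -expr2 sqr_ge0.
(* The bound for P is inherited from S through the comparison of norms. *)
- by move=> f; apply: le_trans (PS _ (svalP f)) (SV_bnd f).
- move=> f g.
  change (Re (ip mu (S (sval f)) (sval g)) = Re (ip mu (sval f) (S (sval g)))).
  by rewrite symS //; exact: svalP.
- by move=> f; apply: posS; exact: svalP.
Qed.

Lemma le_of_A_class : A_class mu T -> {ae mu, forall x, om x <= qq x}.
Proof.
move=> /(_ _ is_abs_T2_Rop) HA.
(* chi om = om gives chi a^2 = a^2, and a cancels where it is nonzero. *)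
have chi_a x : chi x * a x = a x.
  have [->|an0] := eqVneq (a x) 0; first by rewrite mulr0.
  have E := chi_a2 x; rewrite -a2 in E.
  by apply: (mulIf an0); rewrite -mulrA -!expr2.
(* The test vector is conj(u) k with k real: its image under E(u .) is E|u|^2 k = chi k, and chi is
   absorbed by om and by a. *)
have key k : Am k -> sq_integrable mu k ->
    integrableR mu (fun x => om x * k x ^+ 2) ->
    \int[mu]_x (om x * k x ^+ 2) <= \int[mu]_x (a x * k x ^+ 2).
  move=> mk sk iok; pose f := J k (cst 0).
  have m0 : Am (cst (0 : R)) by exact: measurable_cst.
  have s0 : sq_integrable mu (cst (0 : R)).
    split; first exact: measurable_cst.
    by rewrite /integrableR /=; under eq_fun do rewrite expr0n; exact: integrable0.
  have f2 : L2 mu f by exact: L2_J.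
  have E1 : {ae mu, forall x, e1 f x = chi x * k x}.
    apply: (has_condexp_unique sf (he1 f2)); first exact: sub_measurableM.
    move=> p mp sp; have [ih _ _ _] := pair_h mp sp f2.
    have ipk := sq_integrable_mul sp sk.
    have ic : integrableR mu (fun x => p x * k x * chi x).
      apply: integrableR_le (integrable_norm ipk).
        by apply: Am_measurable; apply: sub_measurableM => //; exact: sub_measurableM.
      by move=> x; rewrite /= normrM (ger0_norm (chi0 x)); apply: ler_piMr.
    have mnorm : measurable_fun setT (fun x => u1 x ^+ 2 + u2 x ^+ 2).
      by apply: measurable_funD; exact: measurable_funX.
    have [_ /(_ ic) E] := condexp_nonneg_integrableR sf mnorm
      (fun x => addr_ge0 (sqr_ge0 (u1 x)) (sqr_ge0 (u2 x))) cu
      (sub_measurableM mp mk).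
    have cE : (fun x => p x * (chi x * k x)) = (fun x => p x * k x * chi x).
      by apply/funext => x; ring.
    rewrite cE; split => //; rewrite -E; apply: eq_Rintegral => x _ /=; ring.
  have E2 : {ae mu, forall x, e2 f x = 0}.
    apply: (has_condexp_unique sf (he2 f2) m0) => p mp sp.
    have [_ ih _ _] := pair_h mp sp f2; split => //.
      exact: sq_integrable_mul sp s0.
    by apply: eq_Rintegral => x _ /=; ring.
  have mX (p : X -> R) : Am p -> Am (fun x => p x ^+ 2).
    by move=> mp; exact: sub_measurableM.
  have := HA _ f2; rewrite norm2sq_T // ip_Rop // [leRHS]/=.
  have mee : Am (fun x => e1 f x * e1 f x + e2 f x * e2 f x).
    have A1 := me1 f2; have A2 := me2 f2.
    by apply: sub_measurableD; exact: sub_measurableM.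
  rewrite (ae_eq_Rintegral (g := fun x => om x * k x ^+ 2)); last first.
  - apply: filterS2 E1 E2 => x -> ->.
    transitivity (chi x * (chi x * om x) * k x ^+ 2); first ring.
    by rewrite !chi_om.
  - exact: integrableR_measurable iok.
  - by apply: Am_measurable; exact: sub_measurableM.
  rewrite [leRHS](ae_eq_Rintegral (g := fun x => a x * k x ^+ 2)) //.
  - by apply: Am_measurable; exact: sub_measurableM.
  - by apply: Am_measurable; apply: sub_measurableM => //; exact: mX.
  - apply: filterS2 E1 E2 => x -> ->.
    transitivity (chi x * (chi x * a x) * k x ^+ 2); first ring.
    by rewrite !chi_a.
(* Truncations of the indicator of B are square-integrable choices of k; against their squares om -
   a is nonnegative with integral at most 0, so B is null. *)
pose B := [set x | a x < om x].
have AB : A B.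
  rewrite -(measurable_subE sA) -[X in measurable X]setTI.
  have := (@measurable_fun_ltr _ (g_sigma_algebraType A) _ setT a om ma mom).
  move=> /(_ measurableT [set true]); rewrite setTI => H.
  rewrite (_ : B = (fun x => a x < om x) @^-1` [set true]) ?setTI; first exact: H.
  by apply/seteqP; split => x /=.
have mz : Am (\1_B : X -> R).
  by apply: (@measurable_indic _ (g_sigma_algebraType A)); rewrite (measurable_subE sA).
have [t [mt st tz tev _]] := truncation_exists sf mz.
have tB n x : t n x = 0 \/ t n x ^+ 2 = 1 /\ a x < om x.
  have [->|->] := tz n x; last by left.
  rewrite indicE; case: (boolP (x \in B)) => xB; last by left.
  by right; rewrite expr1n; split => //; exact: set_mem xB.
have tn n : {ae mu, forall x, (om x - a x) * t n x ^+ 2 = 0}.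
  have mt2 : Am (fun x => t n x ^+ 2) by exact: sub_measurableM.
  have i1 : integrableR mu (fun x => om x * t n x ^+ 2).
    apply: integrableR_le (integrableR_Z K (st n).2).
      by apply: Am_measurable; exact: sub_measurableM.
    move=> x; rewrite ger0_norm; last by apply: mulr_ge0 => //; exact: sqr_ge0.
    by apply: ler_wpM2r => //; exact: sqr_ge0.
  have i2 : integrableR mu (fun x => a x * t n x ^+ 2).
    apply: integrableR_le i1.
      by apply: Am_measurable; exact: sub_measurableM.
    move=> x; rewrite ger0_norm; last by apply: mulr_ge0 => //; exact: sqr_ge0.
    by have [->|[-> /ltW]] := tB n x; rewrite ?expr0n ?mulr0 ?mulr1.
  have i := integrableR_B i1 i2.
  have E : (fun x => om x * t n x ^+ 2 - a x * t n x ^+ 2) =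
     (fun x => (om x - a x) * t n x ^+ 2) by apply/funext => x; ring.
  apply: ae_eq0_of_Rintegral_le0; first by rewrite -E.
    move=> x; have [->|[-> /ltW lt]] := tB n x; first by rewrite expr0n mulr0.
    by rewrite mulr1 subr_ge0.
  by rewrite -E RintegralB // subr_le0; exact: key.
have := ae_foralln tn; apply: filterS => x tx.
have om_a : om x <= a x.
  rewrite leNgt; apply/negP => lt; have [n tnx] := tev x.
  have := tx n; rewrite tnx indicE (mem_set (lt : B x)) expr1n mulr1 => /eqP.
  by rewrite gt_eqF // subr_gt0.
(* From om <= a to om <= |q|^2: om^2 <= a^2 = om |q|^2, and om > 0 is cancelled. *)
have [oz|on0] := eqVneq (om x) 0; first by rewrite oz.
have op : 0 < om x by rewrite lt_neqAle eq_sym on0 om0.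
rewrite -(ler_pM2l op) -a2 expr2.
by apply: ler_pM.
Qed.

End NormalizedOperator.

(** * Comparison and scaling of nonnegative conditional expectations *)

Section CondexpNonneg.
Context {R : realType} {d : measure_display} {X : measurableType d}.
Variables (mu : {measure set X -> \bar R}) (A : set (set X)).
Hypotheses (sf : sub_sigma_finite mu A).
Local Notation XA := (g_sigma_algebraType A).
Local Notation Am := (sub_measurable A).
Let sA : sigma_algebra setT A. Proof. by case: sf. Qed.
Let subA : A `<=` measurable. Proof. by case: sf. Qed.

(** The set {psi < phi} is covered by sets [B n] of finite measure on which psi <= n and psi + 1 /
    (n + 1) <= phi. There psi has a finite integral, which cancels and leaves mu (B n) / (n + 1) <=
    0, even if phi is infinite. *)
Lemma ae_le_of_integral_le (phi psi : X -> \bar R) :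
  Am phi -> Am psi -> (forall x, 0 <= phi x)%E -> (forall x, 0 <= psi x)%E ->
  (forall B, A B -> (mu B < +oo)%E ->
    (\int[mu]_(x in B) phi x <= \int[mu]_(x in B) psi x)%E) ->
  {ae mu, forall x, (phi x <= psi x)%E}.
Proof.
move=> mphi mpsi phi0 psi0 le.
have [F [AF muF ndF FT]] := sub_exhaustion sf.
pose B n := F n `&` ([set x | psi x + (n.+1%:R^-1)%:E <= phi x]%E `&`
  [set x | psi x <= n%:R%:E]%E).
have mpsiX := sub_measurableW sA subA mpsi.
have mphiX := sub_measurableW sA subA mphi.
have AB n : A (B n).
  rewrite -(measurable_subE sA); apply: (@measurableI _ XA).
    by rewrite (measurable_subE sA).
  apply: (@measurableI _ XA); rewrite -[X in measurable X]setTI.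
    apply: (@measurable_lee _ XA) => //.
    by apply: (@emeasurable_funD _ XA) => //; exact: measurable_cst.
  by apply: (@measurable_lee _ XA) => //; exact: measurable_cst.
have mB n : measurable (B n) by exact: subA.
have muB n : (mu (B n) < +oo)%E.
  apply: le_lt_trans (muF n); apply: le_measure; rewrite ?inE //; last by move=> x [].
  exact: subA.
have B0 n : mu (B n) = 0%E.
  have h1 := le _ (AB n) (muB n).
  have h2 : (\int[mu]_(x in B n) psi x <= \int[mu]_(x in B n) (cst n%:R%:E) x)%E.
    apply: ge0_le_integral => //; first exact: measurable_funTS.
    by move=> x [_ []].
  have fin : (\int[mu]_(x in B n) psi x)%E \is a fin_num.
    rewrite ge0_fin_numE ?integral_ge0 //; apply: le_lt_trans h2 _.
    by rewrite integral_cst // lte_mul_pinfty.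
  have h3 : (\int[mu]_(x in B n) (psi x + (n.+1%:R^-1)%:E) <=
      \int[mu]_(x in B n) phi x)%E.
    apply: ge0_le_integral => //.
    - by move=> x _; rewrite adde_ge0 // lee_fin.
    - by apply: measurable_funTS; apply: emeasurable_funD.
    - exact: measurable_funTS.
    - by move=> x [_ []].
  have := le_trans h3 h1.
  rewrite (ge0_integralD mu (mB n) (fun x _ => psi0 x) (measurable_funTS mpsiX)
    (f2 := cst (n.+1%:R^-1)%:E)) //; last by move=> x _; rewrite lee_fin.
  rewrite -[leRHS]adde0 leeD2lE // integral_cst //.
  rewrite pmule_rle0 ?lte_fin ?invr_gt0 // => mu0.
  by apply/eqP; rewrite eq_le mu0 measure_ge0.
have : mu.-negligible (\bigcup_n B n).
  by apply: negligible_bigcup => n; exists (B n); split.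
apply: negligibleS => x /= /negP; rewrite -ltNge => lt.
have pfin : psi x \is a fin_num.
  by rewrite ge0_fin_numE //; apply: lt_le_trans lt (leey _).
have [i _ Fix] : (\bigcup_i F i) x by rewrite FT.
pose r := fine (psi x).
have rE : psi x = r%:E by rewrite fineK.
have r0 : 0 <= r by rewrite fine_ge0.
have [m hm] : exists m : nat, (psi x + (m.+1%:R^-1)%:E <= phi x)%E.
  move: lt; rewrite rE; case: (phi x) => [s| |//]; last by exists 0%N; rewrite leey.
  rewrite lte_fin => rs; exists (Num.truncn (s - r)^-1).
  rewrite -EFinD lee_fin -lerBrDl -[leRHS]invrK lef_pV2 ?posrE ?invr_gt0 ?subr_gt0 //.
  by apply: ltW; exact: truncnS_gt.
pose k := (Num.truncn r).+1.
have rk : r <= k%:R by apply: ltW; exact: truncnS_gt.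
pose n := maxn i (maxn m k).
exists n => //; split.
  by have /subsetPset := ndF _ _ (leq_maxl i (maxn m k)); apply.
split => /=.
  apply: le_trans hm; apply: leeD2l; rewrite lee_fin lef_pV2 ?posrE //.
  by rewrite ler_nat ltnS /n; apply: leq_trans (leq_maxr _ _); exact: leq_maxl.
rewrite rE lee_fin; apply: le_trans rk _.
by rewrite ler_nat /n; apply: leq_trans (leq_maxr _ _); exact: leq_maxr.
Qed.

Lemma condexp_nonneg_scale (f g c : X -> \bar R) :
  measurable_fun setT f -> (forall x, 0 <= f x)%E ->
  condexp_nonneg mu A f g -> Am c -> (forall x, 0 <= c x)%E ->
  condexp_nonneg mu A (fun x => c x * f x)%E (fun x => c x * g x)%E.
Proof.
move=> mf f0 fg mc c0; have [/(A_measurableP sA) mg g0 _] := fg; split.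
- by apply/(A_measurableP sA); exact: (@emeasurable_funM _ XA).
- by move=> x; exact: mule_ge0.
move=> B AB; have mB := subA AB.
pose cB := fun x => (c x * (\1_B x)%:E)%E.
have mcB : Am cB.
  apply: (@emeasurable_funM _ XA) => //; apply/measurable_EFinP.
  by apply: (@measurable_indic _ XA); rewrite (measurable_subE sA).
have cB0 x : (0 <= cB x)%E by rewrite mule_ge0 // lee_fin.
have E (k : X -> \bar R) : (\int[mu]_(x in B) (c x * k x) = \int[mu]_x (cB x * k x))%E.
  rewrite integral_mkcond; apply: eq_integral => x _.
  by rewrite epatch_indic /cB muleAC.
rewrite !E; exact: (condexp_nonneg_pullout sA subA mf f0 fg mcB cB0).
Qed.

(** The set {g = 0} is in A, so f has integral 0 over it. *)
Lemma condexp_nonneg_eq0 (f g : X -> \bar R) :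
  measurable_fun setT f -> (forall x, 0 <= f x)%E ->
  condexp_nonneg mu A f g -> {ae mu, forall x, g x = 0%E -> f x = 0%E}.
Proof.
move=> mf f0 [/(A_measurableP sA) mg g0 fg].
pose B := [set x | g x = 0%E].
have AB : A B.
  rewrite -(measurable_subE sA) -[X in measurable X]setTI.
  by apply: (@measurable_eqe _ XA) => //; exact: measurable_cst.
have mB := subA AB.
have int0 : (\int[mu]_(x in B) `|f x| = 0)%E.
  under eq_integral do rewrite gee0_abs //.
  by rewrite fg //; apply: integral0_eq.
have [+ _] := ae_eq_integral_abs mu mB (measurable_funTS mf).
by move=> /(_ int0); apply: filterS => x H gx; exact: H.
Qed.

End CondexpNonneg.

Lemma measurable_fun_inv_ge0 {R : realType} {d : measure_display}
    {X : measurableType d} (f : X -> R) :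
  measurable_fun setT f -> (forall x, 0 <= f x) ->
  measurable_fun setT (fun x => (f x)^-1).
Proof.
move=> mf f0; under eq_fun do rewrite -powR_inv1 //.
exact: measurableT_comp (measurable_powR _) mf.
Qed.

(** * Boundedness of T forces E|u|^2 E|w|^2 <= K *)

Section WeightedCondexp.
Context {R : realType} {d : measure_display} {X : measurableType d}.
Variables (mu : {measure set X -> \bar R}) (A : set (set X)).
Hypotheses (sf : sub_sigma_finite mu A).
Local Notation XA := (g_sigma_algebraType A).
Local Notation Am := (sub_measurable A).
Local Notation Re := complex.Re.
Local Notation Im := complex.Im.
Let sA : sigma_algebra setT A. Proof. by case: sf. Qed.
Let subA : A `<=` measurable. Proof. by case: sf. Qed.

Variables (u w : X -> R[i]) (T : (X -> R[i]) -> (X -> R[i])) (K : R).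
Hypotheses (meas_u : cmeasurable u) (meas_w : cmeasurable w).
Hypotheses (wceT : is_wce_op mu A u w T) (K0 : 0 <= K)
  (bT : forall f, L2 mu f ->
    L2 mu (T f) /\ (norm2sq mu (T f) <= K%:E * norm2sq mu f)%E).
Variables (eu ew : X -> \bar R).
Hypotheses (ceu : condexp_nonneg mu A (fun x => (cnormsq (u x))%:E) eu)
  (cew : condexp_nonneg mu A (fun x => (cnormsq (w x))%:E) ew).

Let meu : Am eu. Proof. by have [/(A_measurableP sA)] := ceu. Qed.
Let mew : Am ew. Proof. by have [/(A_measurableP sA)] := cew. Qed.
Let eu0 x : (0 <= eu x)%E. Proof. by have [_] := ceu. Qed.
Let ew0 x : (0 <= ew x)%E. Proof. by have [_] := cew. Qed.

Lemma measurable_cnormsq (f : X -> R[i]) : cmeasurable f ->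
  measurable_fun setT (fun x => cnormsq (f x)).
Proof. by move=> [m1 m2]; apply: measurable_funD; exact: measurable_funX. Qed.

Lemma cnormsq_ge0 (z : R[i]) : 0 <= cnormsq z.
Proof. by rewrite addr_ge0 ?sqr_ge0. Qed.

(* The [K / E|w|^2] that bounds [E|u|^2]; it is [0] where [E|w|^2] is infinite. *)
Definition inv_bound x : \bar R :=
  if ew x == 0%E then +oo%E else (K / fine (ew x))%:E.

Let inv_bound_ge0 x : (0 <= inv_bound x)%E.
Proof.
rewrite /inv_bound; case: ifP => // _.
by rewrite lee_fin divr_ge0 // fine_ge0.
Qed.

Let measurable_inv_bound : Am inv_bound.
Proof.
apply: (@measurable_fun_ifT _ _ XA).
- apply: (@measurable_fun_eqe _ XA) => //; exact: measurable_cst.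
- exact: measurable_cst.
apply/measurable_EFinP; apply: (@measurable_funM _ XA); first exact: measurable_cst.
apply: (@measurable_fun_inv_ge0 _ _ XA) => [|x]; last exact: fine_ge0.
exact: (@measurableT_comp _ _ _ XA).
Qed.

(** The indicator of {|u|^2 <= n}, which makes conj(u) square-integrable over sets of finite
    measure. *)
Let cut (n : nat) (x : X) : R :=
  if cnormsq (u x) <= n%:R then 1 else 0.

Let cut_bnd n x : cut n x * cnormsq (u x) <= n%:R.
Proof. by rewrite /cut; case: ifP; rewrite ?mul1r ?mul0r. Qed.

Let cut2 n x : cut n x ^+ 2 = cut n x.
Proof. by rewrite /cut; case: ifP; rewrite ?expr1n ?expr0n. Qed.

Let cut0 n x : 0 <= cut n x. Proof. by rewrite /cut; case: ifP. Qed.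

Let mcut n : measurable_fun setT (cut n).
Proof.
apply: measurable_fun_ifT; [|exact: measurable_cst..].
by apply: measurable_fun_ler => //; exact: measurable_cnormsq.
Qed.

Let mcutu n : measurable_fun setT (fun x => cut n x * cnormsq (u x)).
Proof. by apply: measurable_funM => //; exact: measurable_cnormsq. Qed.

Let cutu0 n x : 0 <= cut n x * cnormsq (u x).
Proof. by rewrite mulr_ge0 ?cnormsq_ge0. Qed.

(** With v = E(cut |u|^2), the bound of T at conj(u) cut 1_B reads \int_B v^2 E|w|^2 <= K \int_B v.
    As B varies in A this gives v^2 E|w|^2 <= K v, and v is cancelled. *)
Let cut_condexp_bound n (v : X -> \bar R) :
  condexp_nonneg mu A (fun x => (cut n x * cnormsq (u x))%:E) v ->
  {ae mu, forall x, (v x <= inv_bound x)%E}.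
Proof.
move=> cv; have [/(A_measurableP sA) mv v0 vE] := cv.
have mfv : Am (fun x => fine (v x)) by apply: (@measurableT_comp _ _ _ XA).
(* Makes v finite almost everywhere, so that [fine (v x)] may stand for it. *)
have vn : {ae mu, forall x, (v x <= n%:R%:E)%E}.
  apply: (ae_le_of_integral_le sf (psi := cst n%:R%:E)) => //.
  - exact: measurable_cst.
  - by move=> x; rewrite lee_fin.
  move=> B AB _; rewrite -vE //; apply: ge0_le_integral => //.
  - exact: subA.
  - by move=> x _; rewrite lee_fin.
  - by apply/measurable_EFinP/measurable_funTS.
  - by move=> x _; rewrite lee_fin.
have main : {ae mu, forall x, ((fine (v x) ^+ 2)%:E * ew x <= K%:E * v x)%E}.
  have msq : Am (fun x => (fine (v x) ^+ 2)%:E).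
    by apply/measurable_EFinP; exact: (@measurable_funX _ XA).
  apply: (ae_le_of_integral_le sf).
  - exact: (@emeasurable_funM _ XA).
  - exact: (@measurable_funeM _ XA).
  - by move=> x; rewrite mule_ge0 // lee_fin sqr_ge0.
  - by move=> x; rewrite mule_ge0 // lee_fin.
  move=> B AB muB; have mB := subA AB.
  (* [f] is [conj(u)] cut down to [B] and to [|u|^2 <= n], so that [E(uf) = v] on [B]. *)
  pose f x : R[i] := Complex (cut n x * \1_B x * Re (u x))
                             (cut n x * \1_B x * (- Im (u x))).
  have ind2 x : \1_B x ^+ 2 = \1_B x :> R.
    by rewrite indicE; case: (x \in B); rewrite ?expr1n ?expr0n.
  have m1 : measurable_fun setT (\1_B : X -> R) by exact: measurable_indic.
  have nf x : cnormsq (f x) = cut n x * cnormsq (u x) * \1_B x.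
    rewrite /cnormsq /f /=.
    transitivity (cut n x ^+ 2 * \1_B x ^+ 2 * (Re (u x) ^+ 2 + Im (u x) ^+ 2)); first ring.
    by rewrite cut2 ind2; ring.
  have nfE : norm2sq mu f = (\int[mu]_(x in B) v x)%E.
    rewrite /norm2sq -vE // [RHS]integral_mkcond; apply: eq_integral => x _.
    by rewrite epatch_indic nf EFinM.
  have f2 : L2 mu f.
    split; first by split; apply: measurable_funM => //=;
      [exact: measurable_funM|exact: meas_u.1|exact: measurable_funM|
       by apply: measurable_funN; exact: meas_u.2].
    rewrite nfE -vE //.
    apply: (@le_lt_trans _ _ (\int[mu]_(x in B) (cst n%:R%:E) x)%E).
      apply: ge0_le_integral => //.
      - by move=> x _; rewrite lee_fin.
      - by apply/measurable_EFinP/measurable_funTS.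
      - by move=> x _; rewrite lee_fin.
    by rewrite integral_cst // lte_mul_pinfty.
  (* The product uf = cut |u|^2 1_B is real and nonnegative, so three of its four parts have
     conditional expectation 0; [fine 0] is kept to match the shape in [condexp]. *)
  pose g x : R[i] := Complex (fine (v x * (\1_B x)%:E) - fine 0%E) (fine 0%E - fine 0%E).
  have cg : condexp mu A (fun x => cmul (u x) (f x)) g.
    have c0 : condexp_nonneg mu A (fun _ => 0%:E) (cst 0%E).
      by split => //; apply/(A_measurableP sA); exact: measurable_cst.
    have rE x : Re (cmul (u x) (f x)) = cut n x * cnormsq (u x) * \1_B x.
      by rewrite /cnormsq /=; ring.
    have iE x : Im (cmul (u x) (f x)) = 0 by rewrite /=; ring.
    have p0 : posp (0 : R) = 0 by rewrite /posp maxxx.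
    have n0 : negp (0 : R) = 0 by rewrite /negp oppr0 maxxx.
    exists (fun x => v x * (\1_B x)%:E)%E, (cst 0%E), (cst 0%E), (cst 0%E); split => //.
    - rewrite (_ : (fun x => _) = (fun x => (\1_B x)%:E * (cut n x * cnormsq (u x))%:E)%E).
        rewrite (_ : (fun x => v x * _)%E = (fun x => (\1_B x)%:E * v x)%E).
          have mh : measurable_fun setT (fun x => (cut n x * cnormsq (u x))%:E).
            exact/measurable_EFinP.
          have mB1 : Am (fun x => (\1_B x : R)%:E).
            apply/measurable_EFinP; apply: (@measurable_indic _ XA).
            by rewrite (measurable_subE sA).
          have h0 x : (0 <= (cut n x * cnormsq (u x))%:E)%E by rewrite lee_fin.
          have i0 x : (0 <= (\1_B x : R)%:E)%E by rewrite lee_fin.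
          exact: (condexp_nonneg_scale sf mh h0 cv mB1 i0).
        by apply/funext => x; rewrite muleC.
      apply/funext => x; rewrite rE /posp max_l; last by apply: mulr_ge0.
      by rewrite -EFinM mulrC.
    - have -> : (fun x => (negp (Re (cmul (u x) (f x))))%:E) = (fun _ => 0%:E) => //.
      by apply/funext => x; rewrite rE /negp max_r // oppr_le0; apply: mulr_ge0.
    - have -> : (fun x => (posp (Im (cmul (u x) (f x))))%:E) = (fun _ => 0%:E) => //.
      by apply/funext => x; rewrite iE p0.
    - have -> : (fun x => (negp (Im (cmul (u x) (f x))))%:E) = (fun _ => 0%:E) => //.
      by apply/funext => x; rewrite iE n0.
  have [TL le] := bT f2.
  have TE := wceT f2 cg.
  have nTE : norm2sq mu (T f) =
      (\int[mu]_(x in B) ((fine (v x) ^+ 2)%:E * ew x))%E.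
    pose c x := ((fine (v x) ^+ 2)%:E * (\1_B x)%:E)%E.
    have mc : Am c.
      apply: (@emeasurable_funM _ XA) => //; apply/measurable_EFinP.
      by apply: (@measurable_indic _ XA); rewrite (measurable_subE sA).
    have c0 x : (0 <= c x)%E by rewrite mule_ge0 // lee_fin ?sqr_ge0.
    have mcX := sub_measurableW sA subA mc.
    have mwE : measurable_fun setT (fun x => (cnormsq (w x))%:E).
      by apply/measurable_EFinP; exact: measurable_cnormsq.
    transitivity (\int[mu]_x (c x * (cnormsq (w x))%:E))%E.
      apply: ge0_ae_eq_integral => //.
      - by apply/measurable_EFinP; apply: measurable_cnormsq; case: TL.
      - exact: emeasurable_funM.
      - by move=> x _; rewrite lee_fin cnormsq_ge0.
      - by move=> x _; rewrite mule_ge0 // lee_fin cnormsq_ge0.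
      apply: filterS TE => x -> _; rewrite /c -!EFinM; congr EFin.
      rewrite /g /cnormsq /= !subr0 indicE.
      by case: (x \in B); rewrite ?mule1 ?mule0 /=; ring.
    rewrite (condexp_nonneg_pullout sA subA mwE _ cew mc c0); last first.
      by move=> x; rewrite lee_fin cnormsq_ge0.
    rewrite [RHS]integral_mkcond; apply: eq_integral => x _.
    by rewrite epatch_indic /c muleAC.
  rewrite -nTE; apply: le_trans le _; rewrite nfE ge0_integralZl //.
  by apply: measurable_funTS; exact: sub_measurableW mv.
apply: filterS2 vn main => x.
rewrite /inv_bound; case: eqVneq => [_ _ _|]; first exact: leey.
have := v0 x; have := ew0 x; case: (v x) => [r| |] //.
rewrite lee_fin; case: (ew x) => [s| |] //= s0 r0 sn0 rn.
  have sp : 0 < s by rewrite lt_neqAle eq_sym -lee_fin s0 andbT; apply: contra sn0 => /eqP ->.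
  rewrite -!EFinM !lee_fin => le; rewrite ler_pdivlMr //.
  have [->|rn0] := eqVneq r 0; first by rewrite mul0r.
  have rp : 0 < r by rewrite lt_neqAle eq_sym rn0.
  by rewrite -(ler_pM2l rp) mulrA -expr2 [leRHS]mulrC.
(* Here E|w|^2 is infinite and [inv_bound] is K / 0 = 0. A positive v would make v^2 E|w|^2
   infinite, against the finite K v. *)
rewrite invr0 mulr0 lee_fin.
have [->|rn0] := eqVneq r 0; first by [].
rewrite mulry gtr0_sg ?mul1e; last by rewrite exprn_gt0 // lt_neqAle eq_sym rn0.
by rewrite -EFinM.
Qed.

(** The bound passes from the cuts to |u|^2 by monotone convergence of integrals over sets of A,
    which avoids comparing versions of E(cut |u|^2) for different n. *)
Lemma condexp_normsq_bound : {ae mu, forall x, (eu x <= inv_bound x)%E}.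
Proof.
have [_ _ ueE] := ceu.
apply: (ae_le_of_integral_le sf) => // B AB _; have mB := subA AB.
rewrite -ueE //.
have cvg : (\int[mu]_(x in B) (cnormsq (u x))%:E =
    limn (fun n => \int[mu]_(x in B) (cut n x * cnormsq (u x))%:E))%E.
  rewrite -monotone_convergence //.
  - apply: eq_integral => x _; apply/esym/cvg_lim => //.
    apply: cvg_near_cst; exists (Num.truncn (cnormsq (u x))).+1 => // n /= ln.
    rewrite /cut (_ : _ <= _ = true) ?mul1r //.
    apply/ltW/(lt_le_trans (truncnS_gt _)); by rewrite ler_nat.
  - by move=> n; apply/measurable_EFinP/measurable_funTS.
  - by move=> n x _; rewrite lee_fin.
  - move=> x _ m n mn; rewrite lee_fin; apply: ler_wpM2r; first exact: cnormsq_ge0.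
    rewrite /cut; case: ifP => // lm; last by case: ifP.
    by rewrite (le_trans lm) // ler_nat.
rewrite cvg; apply: lime_le.
  apply: ereal_nondecreasing_is_cvgn => m n mn; apply: ge0_le_integral => //.
  - by move=> x _; rewrite lee_fin.
  - by apply/measurable_EFinP/measurable_funTS.
  - by apply/measurable_EFinP/measurable_funTS.
  - move=> x _; rewrite lee_fin; apply: ler_wpM2r; first exact: cnormsq_ge0.
    rewrite /cut; case: ifP => // lm; last by case: ifP.
    by rewrite (le_trans lm) // ler_nat.
apply: nearW => n.
have [v cv] := condexp_nonneg_exists sA subA sf (mcutu n) (cutu0 n).
have [/(A_measurableP sA) mv v0 vE] := cv.
rewrite vE //; apply: ae_ge0_le_integral => //.
- by apply: measurable_funTS; exact: sub_measurableW mv.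
- by apply: measurable_funTS; exact: sub_measurableW measurable_inv_bound.
- by apply: filterS (cut_condexp_bound cv) => x.
Qed.

End WeightedCondexp.

(** * Reduction to the normalized operator *)

Section Reduction.
Context {R : realType} {d : measure_display} {X : measurableType d}.
Variables (mu : {measure set X -> \bar R}) (A : set (set X)).
Hypotheses (sf : sub_sigma_finite mu A).
Local Notation XA := (g_sigma_algebraType A).
Local Notation Am := (sub_measurable A).
Local Notation Re := complex.Re.
Local Notation Im := complex.Im.
Let sA : sigma_algebra setT A. Proof. by case: sf. Qed.
Let subA : A `<=` measurable. Proof. by case: sf. Qed.

(** Locality of E, by testing against k 1_N. It yields E(uf) = 0 where E|u|^2 = 0. *)
Lemma has_condexp_ae_eq0 (h g : X -> R) (N : set X) : A N ->
  has_condexp mu A h g -> {ae mu, forall x, N x -> h x = 0} ->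
  {ae mu, forall x, N x -> g x = 0}.
Proof.
move=> AN hg h0.
have mN : Am (\1_N : X -> R).
  by apply: (@measurable_indic _ XA); rewrite (measurable_subE sA).
have m0 : Am (cst (0 : R)) by exact: measurable_cst.
have hNg := has_condexp_scale sA subA mN hg.
have : {ae mu, forall x, \1_N x * g x = (cst 0 : X -> R) x}.
  apply: (has_condexp_unique sf hNg m0) => k mk sk.
  have zero : {ae mu, forall x, 0 = k x * (\1_N x * h x)}.
    apply: filterS h0 => x h0; rewrite indicE.
    case: (boolP (x \in N)) => xN; last by rewrite mul0r mulr0.
    by rewrite (h0 (set_mem xN)) !mulr0.
  have mkh : measurable_fun setT (fun x => k x * (\1_N x * h x)).
    apply: measurable_funM; first exact: sub_measurableW mk.
    by apply: measurable_funM; [exact: sub_measurableW mN|case: hg].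
  have i0 : integrableR mu (fun _ => 0) by exact: integrable0.
  split.
  - exact: ae_eq_integrableR mkh zero i0.
  - by move: i0; congr (integrableR mu _); apply/funext => x; rewrite mulr0.
  - rewrite -(ae_eq_Rintegral _ mkh zero); last exact: measurable_cst.
    by apply: eq_Rintegral => x _; rewrite mulr0.
apply: filterS => x /= + Nx.
by rewrite indicE (mem_set Nx) mul1r.
Qed.

Variables (u w : X -> R[i]) (T : (X -> R[i]) -> (X -> R[i])).
Hypotheses (meas_u : cmeasurable u) (meas_w : cmeasurable w).
Hypotheses (wceT : is_wce_op mu A u w T) (bT : bounded_L2 mu T).
Variables (eu ew : X -> \bar R) (euw : X -> R[i]).
Hypotheses (ceu : condexp_nonneg mu A (fun x => (cnormsq (u x))%:E) eu)
  (cew : condexp_nonneg mu A (fun x => (cnormsq (w x))%:E) ew)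
  (ceuw : condexp mu A (fun x => cmul (u x) (w x)) euw).

Let measurable_cmul (f g : X -> R[i]) : cmeasurable f -> cmeasurable g ->
  cmeasurable (fun x => cmul (f x) (g x)).
Proof.
move=> [f1 f2] [g1 g2]; split => /=.
  by apply: measurable_funB; exact: measurable_funM.
by apply: measurable_funD; exact: measurable_funM.
Qed.

(** The factors kap and sig are A-measurable with product chi, so (sig w) E(kap u f) = chi w E(uf),
    which is T f almost everywhere, and E(kap u sig w) = chi E(uw). On G the normalized inequality
    is the original one; off G both have left side 0, almost everywhere. *)
Lemma A_class_iff_ae_le : A_class mu T <->
  {ae mu, forall x, (eu x * ew x <= (cnormsq (euw x))%:E)%E}.
Proof.
have [K0 bK0] := bT.
pose K := `|K0|.
have bK f : L2 mu f -> L2 mu (T f) /\ (norm2sq mu (T f) <= K%:E * norm2sq mu f)%E.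
  move=> f2; have [Tf2 le] := bK0 _ f2; split => //; apply: le_trans le _.
  rewrite norm2sqE // -!EFinM lee_fin; apply: ler_wpM2r; first exact: Reip_ge0.
  exact: ler_norm.
have [/(A_measurableP sA) meu eu0 _] := ceu.
have [/(A_measurableP sA) mew ew0 _] := cew.
have bound := condexp_normsq_bound sf meas_u meas_w wceT (normr_ge0 K0) bK ceu cew.
have mnu : measurable_fun setT (fun x => (cnormsq (u x))%:E).
  by apply/measurable_EFinP; exact: measurable_cnormsq.
have mnw : measurable_fun setT (fun x => (cnormsq (w x))%:E).
  by apply/measurable_EFinP; exact: measurable_cnormsq.
have nu0 x : (0 <= (cnormsq (u x))%:E)%E by rewrite lee_fin cnormsq_ge0.
have nw0 x : (0 <= (cnormsq (w x))%:E)%E by rewrite lee_fin cnormsq_ge0.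
have cnormsq_eq0 (z : R[i]) : cnormsq z = 0 -> Re z = 0 /\ Im z = 0.
  move/eqP; rewrite paddr_eq0 ?sqr_ge0 // !sqrf_eq0 => /andP[/eqP -> /eqP ->].
  by [].
have w_eq0 : {ae mu, forall x, ew x = 0%E -> Re (w x) = 0 /\ Im (w x) = 0}.
  apply: filterS (condexp_nonneg_eq0 sf mnw nw0 cew) => x H /H [].
  exact: cnormsq_eq0.
have u_eq0 : {ae mu, forall x, eu x = 0%E -> Re (u x) = 0 /\ Im (u x) = 0}.
  apply: filterS (condexp_nonneg_eq0 sf mnu nu0 ceu) => x H /H [].
  exact: cnormsq_eq0.
(* The product bound is included so that om <= K holds at every point and not only almost
   everywhere. *)
pose P x := [&& (0 < eu x)%E, (eu x < +oo)%E, (0 < ew x)%E, (ew x < +oo)%E &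
  (eu x * ew x <= K%:E)%E].
pose G := [set x | P x].
have mP : measurable_fun [set: XA] (P : XA -> bool).
  have cm (c : \bar R) : Am (cst c) by exact: measurable_cst.
  by do ![apply: measurable_and]; [exact: (@measurable_fun_lte _ XA)|
    exact: (@measurable_fun_lte _ XA)|exact: (@measurable_fun_lte _ XA)|
    exact: (@measurable_fun_lte _ XA)|
    apply: (@measurable_fun_lee _ XA) => //; exact: (@emeasurable_funM _ XA)].
have AG : A G.
  rewrite -(measurable_subE sA) -[X in measurable X]setTI.
  exact: (mP measurableT [set true]).
(* Infinite values do not escape: [inv_bound] is finite where E|w|^2 is nonzero and 0 where E|w|^2
   is infinite, so each expectation can be infinite only where the other is 0. *)
have cover : {ae mu, forall x, [\/ P x, ew x = 0%E | eu x = 0%E]}.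
  apply: filterS bound => x; rewrite /inv_bound.
  have [->|ewn0] := eqVneq (ew x) 0%E; first by constructor 2.
  have [->|eun0] := eqVneq (eu x) 0%E; first by constructor 3.
  have eup : (0 < eu x)%E by rewrite lt_neqAle eq_sym eun0 eu0.
  have ewp : (0 < ew x)%E by rewrite lt_neqAle eq_sym ewn0 ew0.
  move=> le; constructor 1; rewrite /P eup ewp /=.
  rewrite (le_lt_trans le (ltry _)) /=.
  move: ewp eup le; case: (ew x) => [s| |] //; case: (eu x) => [r| |] // sp rp.
    rewrite !lee_fin => le; rewrite ltry /=.
    by rewrite -ler_pdivlMr.
  by rewrite /= invr0 mulr0 lee_fin leNgt -lte_fin rp.
pose chi : X -> R := \1_G.
have mchi : Am chi.
  by apply: (@measurable_indic _ XA); rewrite (measurable_subE sA).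
have chiP x : P x -> chi x = 1 by move=> Px; rewrite /chi indicE mem_set.
have chiN x : ~~ P x -> chi x = 0.
  by move=> Px; rewrite /chi indicE memNset //; exact/negP.
pose sq x := Num.sqrt (fine (eu x)).
have msq : Am sq.
  have mf : Am (fun x => fine (eu x)) by apply: (@measurableT_comp _ _ _ XA).
  exact: (measurableT_comp (continuous_measurable_fun (@sqrt_continuous R)) mf).
pose kap x := chi x * (sq x)^-1.
pose sig x := chi x * sq x.
have mkap : Am kap.
  apply: sub_measurableM => //; apply: (@measurable_fun_inv_ge0 _ _ XA) => // x.
  exact: sqrtr_ge0.
have msig : Am sig by exact: sub_measurableM.
have euP x : P x -> eu x = (fine (eu x))%:E /\ 0 < fine (eu x).
  case/and5P => eup euf _ _ _; have fin : eu x \is a fin_num by rewrite ge0_fin_numE.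
  by split; [rewrite fineK|rewrite fine_gt0 // eup].
have ewP x : P x -> ew x = (fine (ew x))%:E /\ 0 < fine (ew x).
  case/and5P => _ _ ewp ewf _; have fin : ew x \is a fin_num by rewrite ge0_fin_numE.
  by split; [rewrite fineK|rewrite fine_gt0 // ewp].
have kapsig x : kap x * sig x = chi x.
  have [Px|Px] := boolP (P x); last by rewrite /kap /sig chiN // !mul0r.
  have [_ fp] := euP _ Px; rewrite /kap /sig chiP // !mul1r mulVf //.
  by rewrite gt_eqF // sqrtr_gt0.
pose om x := chi x * (fine (eu x) * fine (ew x)).
have cu : condexp_nonneg mu A
    (fun x => ((kap x * Re (u x)) ^+ 2 + (kap x * Im (u x)) ^+ 2)%:E)
    (fun x => (chi x)%:E).
  have mk2 : Am (fun x => (kap x ^+ 2)%:E).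
    by apply/measurable_EFinP; exact: sub_measurableM.
  have k20 x : (0 <= (kap x ^+ 2)%:E)%E by rewrite lee_fin sqr_ge0.
  have := condexp_nonneg_scale sf mnu nu0 ceu mk2 k20.
  congr (condexp_nonneg mu A _ _); apply/funext => x.
    by rewrite -EFinM /cnormsq; congr EFin; ring.
  have [Px|Px] := boolP (P x); last by rewrite /kap chiN // mul0r expr0n mul0e.
  have [-> fp] := euP _ Px; rewrite -EFinM /kap chiP // mul1r exprVn.
  by rewrite sqr_sqrtr ?ltW // mulVf // gt_eqF.
have cw : condexp_nonneg mu A
    (fun x => ((sig x * Re (w x)) ^+ 2 + (sig x * Im (w x)) ^+ 2)%:E)
    (fun x => (om x)%:E).
  have mk2 : Am (fun x => (sig x ^+ 2)%:E).
    by apply/measurable_EFinP; exact: sub_measurableM.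
  have k20 x : (0 <= (sig x ^+ 2)%:E)%E by rewrite lee_fin sqr_ge0.
  have := condexp_nonneg_scale sf mnw nw0 cew mk2 k20.
  congr (condexp_nonneg mu A _ _); apply/funext => x.
    by rewrite -EFinM /cnormsq; congr EFin; ring.
  have [Px|Px] := boolP (P x); last by rewrite /sig /om chiN // !mul0r expr0n mul0e.
  have [_ fp] := euP _ Px; have [-> _] := ewP _ Px.
  rewrite -EFinM /sig /om chiP // !mul1r /=.
  by rewrite sqr_sqrtr ?ltW.
have chi0 x : 0 <= chi x by rewrite /chi.
have chi1 x : chi x <= 1 by rewrite /chi indicE; case: (_ \in _); rewrite ?lexx.
have chi2 x : chi x * chi x = chi x.
  by have [Px|Px] := boolP (P x); rewrite ?(chiP _ Px) ?(chiN _ Px) ?mulr1 ?mulr0.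
have om0 x : 0 <= om x by rewrite mulr_ge0 // mulr_ge0 // fine_ge0.
have omE x : P x -> (om x)%:E = (eu x * ew x)%E.
  move=> Px; have [-> _] := euP _ Px; have [-> _] := ewP _ Px.
  by rewrite -EFinM /om chiP // mul1r.
have omK x : om x <= K.
  have [Px|Px] := boolP (P x); last by rewrite /om chiN // mul0r normr_ge0.
  by rewrite -lee_fin omE //; case/and5P: Px.
have chi_om x : chi x * om x = om x by rewrite /om mulrA chi2.
pose q1 x := chi x * Re (euw x); pose q2 x := chi x * Im (euw x).
have [cq1 cq2] := condexp_components sA subA (measurable_cmul meas_u meas_w) ceuw.
have hq1 : has_condexp mu A (fun x => kap x * Re (u x) * (sig x * Re (w x)) -
    kap x * Im (u x) * (sig x * Im (w x))) q1.
  have := has_condexp_scale sA subA mchi cq1.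
  congr (has_condexp mu A _ _); apply/funext => x.
  by rewrite -kapsig /=; ring.
have hq2 : has_condexp mu A (fun x => kap x * Re (u x) * (sig x * Im (w x)) +
    kap x * Im (u x) * (sig x * Re (w x))) q2.
  have := has_condexp_scale sA subA mchi cq2.
  congr (has_condexp mu A _ _); apply/funext => x.
  by rewrite -kapsig /=; ring.
(* Fixes one version of E(uf) for each measurable f; the value at any other f is arbitrary. *)
have /choice [g gP] : forall f, exists gf : X -> R[i], cmeasurable f ->
    condexp mu A (fun x => cmul (u x) (f x)) gf.
  move=> f; have [mf|nmf] := pselect (cmeasurable f); last by exists f.
  have [g ?] := condexp_exists sA subA sf (measurable_cmul meas_u mf).
  by exists g.
pose e1 f x := kap x * Re (g f x); pose e2 f x := kap x * Im (g f x).
have cg f : L2 mu f ->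
    has_condexp mu A (fun x => Re (cmul (u x) (f x))) (fun x => Re (g f x)) /\
    has_condexp mu A (fun x => Im (cmul (u x) (f x))) (fun x => Im (g f x)).
  move=> [mf _]; exact: (condexp_components sA subA (measurable_cmul meas_u mf) (gP _ mf)).
have he1 f : L2 mu f -> has_condexp mu A
    (fun x => kap x * Re (u x) * Re (f x) - kap x * Im (u x) * Im (f x)) (e1 f).
  move=> f2; have := has_condexp_scale sA subA mkap (cg _ f2).1.
  by congr (has_condexp mu A _ _); apply/funext => x /=; ring.
have he2 f : L2 mu f -> has_condexp mu A
    (fun x => kap x * Re (u x) * Im (f x) + kap x * Im (u x) * Re (f x)) (e2 f).
  move=> f2; have := has_condexp_scale sA subA mkap (cg _ f2).2.
  by congr (has_condexp mu A _ _); apply/funext => x /=; ring.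
have AN : A [set x | eu x = 0%E].
  rewrite -(measurable_subE sA) -[X in measurable X]setTI.
  by apply: (@measurable_eqe _ XA) => //; exact: measurable_cst.
have hT f : L2 mu f -> {ae mu, forall x, T f x =
    cmulf (fun x => sig x * Re (w x)) (fun x => sig x * Im (w x)) (e1 f) (e2 f) x}.
  move=> f2.
  have g1 : {ae mu, forall x, eu x = 0%E -> Re (g f x) = 0}.
    apply: (has_condexp_ae_eq0 AN (cg _ f2).1).
    by apply: filterS u_eq0 => x H /H /= [-> ->]; ring.
  have g2 : {ae mu, forall x, eu x = 0%E -> Im (g f x) = 0}.
    apply: (has_condexp_ae_eq0 AN (cg _ f2).2).
    by apply: filterS u_eq0 => x H /H /= [-> ->]; ring.
  have Tf := wceT f2 (gP _ f2.1).
  have gg : {ae mu, forall x, eu x = 0%E -> Re (g f x) = 0 /\ Im (g f x) = 0}.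
    by apply: filterS2 g1 g2 => x H1 H2 z; rewrite (H1 z) (H2 z).
  have Tw : {ae mu, forall x, T f x = cmul (w x) (g f x) /\
      (ew x = 0%E -> Re (w x) = 0 /\ Im (w x) = 0)} by apply: filterS2 Tf w_eq0.
  apply: filterS3 Tw gg cover => x [-> wz] gz cov.
  (* Where chi = 0, a factor of w E(uf) vanishes: w if E|w|^2 = 0, and E(uf) if E|u|^2 = 0. *)
  have main : chi x = 1 \/ (Re (w x) = 0 /\ Im (w x) = 0) \/
      (Re (g f x) = 0 /\ Im (g f x) = 0).
    by case: cov => [/chiP|/wz|/gz]; auto.
  rewrite /cmulf /e1 /e2; apply: complex_eqP => /=.
    transitivity (kap x * sig x * (Re (w x) * Re (g f x) - Im (w x) * Im (g f x)));
      last by ring.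
    rewrite kapsig.
    by case: main => [->|[[-> ->]|[-> ->]]]; ring.
  transitivity (kap x * sig x * (Re (w x) * Im (g f x) + Im (w x) * Re (g f x)));
    last by ring.
  rewrite kapsig.
  by case: main => [->|[[-> ->]|[-> ->]]]; ring.
have [mu1 mu2] := meas_u; have [mw1 mw2] := meas_w.
have mkX := sub_measurableW sA subA mkap; have msX := sub_measurableW sA subA msig.
have m1 := measurable_funM mkX mu1; have m2 := measurable_funM mkX mu2.
have m3 := measurable_funM msX mw1; have m4 := measurable_funM msX mw2.
have equiv : A_class mu T <-> {ae mu, forall x, om x <= q1 x ^+ 2 + q2 x ^+ 2}.
  split.
    exact: (le_of_A_class sf m1 m2 m3 m4 cu cw chi0 chi1 om0 omK chi_om hq1 hq2
      he1 he2 hT bT).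
  exact: (A_class_of_le sf m1 m2 m3 m4 cu cw chi0 chi1 om0 omK chi_om hq1 hq2
      he1 he2 hT bT).
have qE x : P x -> q1 x ^+ 2 + q2 x ^+ 2 = cnormsq (euw x).
  by move=> Px; rewrite /q1 /q2 chiP // !mul1r.
apply: (iff_trans equiv); split => H.
  apply: filterS2 H cover => x le [Px|->|->].
  - by rewrite -omE // lee_fin -qE.
  - by rewrite mule0 lee_fin cnormsq_ge0.
  - by rewrite mul0e lee_fin cnormsq_ge0.
apply: filterS H => x le.
have [Px|Px] := boolP (P x); first by rewrite -lee_fin omE // qE.
by rewrite /om chiN // mul0r addr_ge0 ?sqr_ge0.
Qed.

End Reduction.

(** * From the inequality on X to S and S' *)

Theorem theorem2p6 (R : realType) (d : measure_display) (X : measurableType d)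
    (mu : {measure set X -> \bar R}) (A : set (set X))
    (u w : X -> R[i]) (T : (X -> R[i]) -> (X -> R[i])) :
  sigma_finite setT mu -> measure_is_complete mu ->
  sub_sigma_finite mu A ->
  inDE mu A u -> inDE mu A w ->
  is_wce_op mu A u w T -> bounded_L2 mu T ->
  forall (eu ew : X -> \bar R) (euw eu1 : X -> R[i]),
  condexp_nonneg mu A (fun x => (cnormsq (u x))%:E) eu ->
  condexp_nonneg mu A (fun x => (cnormsq (w x))%:E) ew ->
  condexp mu A (fun x => cmul (u x) (w x)) euw ->
  condexp mu A u eu1 ->
  let S := [set x | eu x != 0%E] in
  let S' := [set x | eu1 x != 0] in
  [/\ (ineq_on mu S euw eu ew -> A_class mu T),
      (A_class mu T -> ineq_on mu S' euw eu ew) &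
      (ae_eqset mu S S' -> (A_class mu T <-> ineq_on mu S euw eu ew))].
Proof.
move=> _ _ sf [meas_u _] [meas_w _] wceT bT eu ew euw eu1 ceu cew ceuw _ S S'.
have equiv := A_class_iff_ae_le sf meas_u meas_w wceT bT ceu cew ceuw.
have of_ineq : ineq_on mu S euw eu ew -> A_class mu T.
  move=> H; apply/equiv; apply: filterS H => x H.
  (* Off S the left side is 0 * E|w|^2 = 0, even where E|w|^2 is infinite. *)
  have [->|eun0] := eqVneq (eu x) 0%E; last exact: H.
  by rewrite mul0e lee_fin cnormsq_ge0.
(* An inequality valid on X restricts to any Q, in particular to S and to S'. *)
have to_ineq Q : A_class mu T -> ineq_on mu Q euw eu ew.
  by move/equiv; apply: filterS.
by split => [//||_]; [exact: to_ineq|split; [exact: to_ineq|]].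
Qed.
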